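(* Let $u^i_t=\sum_{j=1}^3 a^i_j(u)\,u^j_x$, $i=1,2,3$, be a three-component hydrodynamic type system whose characteristic velocities $v^1,v^2,v^3$ (the eigenvalues of the matrix $(a^i_j)$) are real and pairwise distinct. Let $\omega^1,\omega^2,\omega^3$ be its eigenforms and let $\Omega,\Omega^1,\Omega^2,\Omega^3$ be the associated 1-forms on the hodograph space (all defined in the context). Let $M$ be a hydrodynamic surface of the system on which the restrictions of $\omega^1,\omega^2,\omega^3$ are pairwise linearly independent at every point. Then the curvature 2-form $C$ of the characteristic 3-web on $M$ is given by $$C=-d\Omega-\tfrac12\, d\left( *\Omega^1+*\Omega^2+*\Omega^3\right),\qquad (\star)$$ where $d\Omega$ is restricted to $M$ and $*\Omega^1,*\Omega^2,*\Omega^3$ are the 1-forms on $M$ defined in the context. Written down in any suitable coordinate system in the hodograph space, equation $(\star)$ reduces to a third order PDE for hydrodynamic surfaces.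
   Context: All objects are smooth and all considerations are local. **Eigenforms.** The hodograph space is the space with coordinates $u^1,u^2,u^3$. Let $l^i=(l^i_1,l^i_2,l^i_3)$ be the left eigenvectors of the matrix $(a^i_j(u))$, $\sum_j l^i_j a^j_k=v^i l^i_k$. The eigenforms are $\omega^i=\sum_j l^i_j\,du^j$; they form a coframe and are defined up to multiplication by nonvanishing functions. The system is equivalent to $\omega^i\wedge(dx+v^i dt)=0$, $i=1,2,3$. The coefficients $v^i_j$ are defined by the expansion of the differentials of the characteristic velocities: $$dv^i=\sum_j v^i_j\,\omega^j .$$ **Hydrodynamic surface.** A hydrodynamic surface is a solution $u=u(x,t)$ of the system viewed as a non-parametrized surface in the hodograph space. **The forms $\Omega^i$ and $\Omega$ on the hodograph space.** $$\Omega^1=\frac{v^1_1(v^2-v^3)}{(v^1-v^2)(v^1-v^3)}\,\omega^1,\quad \Omega^2=\frac{v^2_2(v^3-v^1)}{(v^2-v^1)(v^2-v^3)}\,\omega^2,\quad \Omega^3=\frac{v^3_3(v^1-v^2)}{(v^3-v^1)(v^3-v^2)}\,\omega^3,$$ $$\Omega=\left(\frac{v^2_1-\frac12 v^1_1}{v^1-v^2}+\frac{v^3_1-\frac12 v^1_1}{v^1-v^3}\right)\omega^1+\left(\frac{v^1_2-\frac12 v^2_2}{v^2-v^1}+\frac{v^3_2-\frac12 v^2_2}{v^2-v^3}\right)\omega^2+\left(\frac{v^1_3-\frac12 v^3_3}{v^3-v^1}+\frac{v^2_3-\frac12 v^3_3}{v^3-v^2}\right)\omega^3 .$$ **Characteristic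 3-web and its curvature.** On $M$, the characteristic 3-web consists of the three families of curves $\omega^1=0$, $\omega^2=0$, $\omega^3=0$ (restricted to $M$). Choose 1-forms $\phi^1,\phi^2$ on $M$, proportional to $\omega^1|_M,\omega^2|_M$ respectively, such that the three families are given by $\phi^1=0$, $\phi^2=0$ and $\phi^1=\phi^2$. The connection form $\phi$ is the unique 1-form on $M$ with $d\phi^1=\phi\wedge\phi^1$ and $d\phi^2=\phi\wedge\phi^2$. The curvature 2-form is $C=d\phi$; it does not depend on the choice of $\phi^1,\phi^2$. **The forms $*\Omega^i$ on $M$.** Let $(i,j,k)$ be a cyclic permutation of $(1,2,3)$. Restrict $\Omega^i$ to $M$ and equip $M$ with the pseudo-Riemannian metric $2\omega^j\omega^k$ (that is, $\omega^j\otimes\omega^k+\omega^k\otimes\omega^j$) and the volume form $\omega^j\wedge\omega^k$, both restricted to $M$. Let $X$ be the vector field on $M$ dual to $\Omega^i|_M$ with respect to this metric. Then $*\Omega^i$ is the 1-form $(\omega^j\wedge\omega^k)(X,\cdot)$. Explicitly, if $\Omega^i|_M=\alpha\,\omega^j+\beta\,\omega^k$, then $*\Omega^i=\beta\,\omega^k-\alpha\,\omega^j$. *)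

(* Defs.v *)
From mathcomp Require Import all_boot all_order all_algebra.
From mathcomp Require Import all_classical all_reals all_analysis.

Set Implicit Arguments.
Unset Strict Implicit.
Unset Printing Implicit Defensive.

Import Order.TTheory GRing.Theory Num.Theory.
Import numFieldNormedType.Exports.

Local Open Scope classical_set_scope.
Local Open Scope ring_scope.

(* Points and tangent vectors of R^n are row vectors.  A 1-form is given by the
   row of its components in dx_0, ..., dx_(n-1), so its value on X is
   (w *m X^T) 0 0; a 2-form is given by its (antisymmetric) matrix B of
   components B a b = B(d/dx_a, d/dx_b), so that B(X, Y) = X *m B *m Y^T. *)

Definition pderiv (R : realType) (n : nat) (a : 'I_n)
  (f : 'rV[R]_n -> R) : 'rV[R]_n -> R := fun p => 'D_(delta_mx 0 a) f p.

(* C^oo on the open set U: every iterated partial derivative is (totally)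
   differentiable, hence continuous, at every point of U.  Functions are total,
   but only their values on U matter. *)
Definition smooth (R : realType) (n : nat) (U : set 'rV[R]_n)
  (f : 'rV[R]_n -> R) : Prop :=
  forall (s : seq 'I_n) p, U p -> differentiable (foldr (@pderiv R n) f s) p.

Definition smooth_mx (R : realType) (n k m : nat) (U : set 'rV[R]_n)
  (f : 'rV[R]_n -> 'M[R]_(k, m)) : Prop :=
  forall i j, smooth U (fun p => f p i j).

Definition grad (R : realType) (n : nat) (f : 'rV[R]_n -> R)
  (p : 'rV[R]_n) : 'rV[R]_n := \row_a pderiv a f p.

Definition ext_d (R : realType) (n : nat) (w : 'rV[R]_n -> 'rV[R]_n)
  (p : 'rV[R]_n) : 'M[R]_n :=
  \matrix_(a, b) (pderiv a (fun q => w q 0 b) p - pderiv b (fun q => w q 0 a) p).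

Definition wedge (R : realType) (n : nat) (a b : 'rV[R]_n) : 'M[R]_n :=
  a^T *m b - b^T *m a.

Definition pullback1 (R : realType) (n m : nat) (f : 'rV[R]_n -> 'rV[R]_m)
  (w : 'rV[R]_m -> 'rV[R]_m) (p : 'rV[R]_n) : 'rV[R]_n :=
  w (f p) *m (jacobian f p)^T.

Definition pullback2 (R : realType) (n m : nat) (f : 'rV[R]_n -> 'rV[R]_m)
  (B : 'rV[R]_m -> 'M[R]_m) (p : 'rV[R]_n) : 'M[R]_n :=
  jacobian f p *m B (f p) *m (jacobian f p)^T.

Definition proportional (R : realType) (n : nat) (a b : 'rV[R]_n) : Prop :=
  exists2 c : R, c != 0 & a = c *: b.

Definition pairwise_indep (R : realType) (n : nat)
  (th : 'I_3 -> 'rV[R]_n) : Prop :=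
  forall i j, i != j -> row_free (col_mx (th i) (th j)).

(* Coordinates 0 and 1 of 'rV_2 are x and t. *)
Definition solution (R : realType) (U : set 'rV[R]_3)
  (A : 'rV[R]_3 -> 'M[R]_3) (E : set 'rV[R]_2)
  (u : 'rV[R]_2 -> 'rV[R]_3) : Prop :=
  [/\ open E, smooth_mx E u, forall z, E z -> U (u z) &
      forall z, E z -> forall i : 'I_3,
        pderiv 1 (fun y => u y 0 i) z
        = \sum_(j < 3) A (u z) i j * pderiv 0 (fun y => u y 0 j) z].

(* sigma : D -> U is a (local) parametrisation, with arbitrary parameters, of a
   solution regarded as a non-parametrised surface: it differs from a solution
   by a local diffeomorphism h of the parameters. *)
Definition hydrodynamic_surface (R : realType) (U : set 'rV[R]_3)
  (A : 'rV[R]_3 -> 'M[R]_3) (D : set 'rV[R]_2)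
  (sigma : 'rV[R]_2 -> 'rV[R]_3) : Prop :=
  open D /\
  exists (E : set 'rV[R]_2) (u : 'rV[R]_2 -> 'rV[R]_3)
         (h : 'rV[R]_2 -> 'rV[R]_2),
    [/\ solution U A E u, smooth_mx D h,
        forall s, D s -> E (h s),
        forall s, D s -> jacobian h s \in unitmx &
        forall s, D s -> sigma s = u (h s)].

Section HodographForms.
Variables (R : realType).
Variables (v : 'I_3 -> 'rV[R]_3 -> R) (dv : 'I_3 -> 'I_3 -> 'rV[R]_3 -> R).
Variables (w : 'I_3 -> 'rV[R]_3 -> 'rV[R]_3).

(* Addition in 'I_3 is modulo 3, so (i, i + 1, i + 2) is the cyclic permutation
   of the three indices starting at i; dv i j is the coefficient of w j in
   the expansion of the differential of v i. *)
Definition Omega_i (i : 'I_3) (p : 'rV[R]_3) : 'rV[R]_3 :=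
  let j := i + 1 in let k := i + 2 in
  (dv i i p * (v j p - v k p) / ((v i p - v j p) * (v i p - v k p))) *: w i p.

Definition Omega (p : 'rV[R]_3) : 'rV[R]_3 :=
  \sum_(i < 3) (let j := i + 1 in let k := i + 2 in
    ((dv j i p - 2^-1 * dv i i p) / (v i p - v j p)
     + (dv k i p - 2^-1 * dv i i p) / (v i p - v k p)) *: w i p).

End HodographForms.

(* For linearly independent covectors a, b of the plane: X is the vector dual to
   eta for the metric a (x) b + b (x) a, and the result is the contraction of
   the area form a /\ b with X. *)
Definition hodge (R : realType) (a b eta : 'rV[R]_2) : 'rV[R]_2 :=
  let X := eta *m invmx (a^T *m b + b^T *m a) in X *m wedge a b.

Definition star_Omega_i (R : realType) (v : 'I_3 -> 'rV[R]_3 -> R)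
  (dv : 'I_3 -> 'I_3 -> 'rV[R]_3 -> R) (w : 'I_3 -> 'rV[R]_3 -> 'rV[R]_3)
  (sigma : 'rV[R]_2 -> 'rV[R]_3) (i : 'I_3) (s : 'rV[R]_2) : 'rV[R]_2 :=
  hodge (pullback1 sigma (w (i + 1)) s) (pullback1 sigma (w (i + 2)) s)
        (pullback1 sigma (Omega_i v dv w i) s).

(* C is the curvature on D of the 3-web th 0 = 0, th 1 = 0, th 2 = 0, computed
   from some admissible normalisation ph1, ph2. *)
Definition web_curvature (R : realType) (D : set 'rV[R]_2)
  (th : 'I_3 -> 'rV[R]_2 -> 'rV[R]_2) (C : 'rV[R]_2 -> 'M[R]_2) : Prop :=
  exists ph1 ph2 ph : 'rV[R]_2 -> 'rV[R]_2,
    [/\ [/\ smooth_mx D ph1, smooth_mx D ph2 & smooth_mx D ph],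
        forall s, D s -> [/\ proportional (ph1 s) (th 0 s),
                             proportional (ph2 s) (th 1 s) &
                             proportional (ph1 s - ph2 s) (th 2 s)],
        forall s, D s -> ext_d ph1 s = wedge (ph s) (ph1 s)
                         /\ ext_d ph2 s = wedge (ph s) (ph2 s) &
        forall s, D s -> C s = ext_d ph s].

(* The characteristic web on the surface sigma has a curvature form, which does
   not depend on the normalisation and is given by the formula. *)
Definition star_equation (R : realType) (v : 'I_3 -> 'rV[R]_3 -> R)
  (dv : 'I_3 -> 'I_3 -> 'rV[R]_3 -> R) (w : 'I_3 -> 'rV[R]_3 -> 'rV[R]_3)
  (D : set 'rV[R]_2) (sigma : 'rV[R]_2 -> 'rV[R]_3) : Prop :=
  forall C : 'rV[R]_2 -> 'M[R]_2,
    web_curvature D (fun i => pullback1 sigma (w i)) C <->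
    (forall s, D s ->
       C s = - pullback2 sigma (ext_d (Omega v dv w)) s
             - 2^-1 *: ext_d (fun q => \sum_(i < 3) star_Omega_i v dv w sigma i q) s).

(* psi : V -> U is the inverse of a coordinate system on the open subset psi(V)
   of the hodograph space (inverse function theorem). *)
Definition coordinate_system (R : realType) (U V : set 'rV[R]_3)
  (psi : 'rV[R]_3 -> 'rV[R]_3) : Prop :=
  [/\ open V, smooth_mx V psi, forall y, V y -> U (psi y), set_inj V psi &
      forall y, V y -> jacobian psi y \in unitmx].

Definition graph_pt (R : realType) (f : 'rV[R]_2 -> R) (s : 'rV[R]_2) :
  'rV[R]_3 := \row_(i < 3) [:: s 0 0; s 0 1; f s]`_i.

(* Coordinates on the space of 3-jets of functions of two variables:
   (y0, y1, f, f_0, f_1, f_00, f_01, f_11, f_000, f_001, f_011, f_111). *)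
Definition jet3 (R : realType) (f : 'rV[R]_2 -> R) (s : 'rV[R]_2) :
  'rV[R]_12 :=
  let d (l : seq 'I_2) := foldr (@pderiv R 2) f l s in
  \row_(i < 12) [:: s 0 0; s 0 1; f s;
                    d [:: 0]; d [:: 1];
                    d [:: 0; 0]; d [:: 0; 1]; d [:: 1; 1];
                    d [:: 0; 0; 0]; d [:: 0; 0; 1]; d [:: 0; 1; 1];
                    d [:: 1; 1; 1]]`_i.

Definition jet_pt (R : realType) (J : 'rV[R]_12) : 'rV[R]_3 :=
  \row_(i < 3) J 0 (inord i).

(* The rows span the tangent plane of a graph with the given 1-jet. *)
Definition jet_tangent (R : realType) (J : 'rV[R]_12) : 'M[R]_(2, 3) :=
  \matrix_(a < 2, i < 3)
    (if (i < 2)%N then ((a : nat) == i)%:R else J 0 (inord (3 + a)%N)).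

(* The jets of those graphs, in the coordinates psi, on which the restrictions
   of the forms w 0, w 1, w 2 are pairwise linearly independent. *)
Definition admissible_jet (R : realType) (w : 'I_3 -> 'rV[R]_3 -> 'rV[R]_3)
  (V : set 'rV[R]_3) (psi : 'rV[R]_3 -> 'rV[R]_3) : set 'rV[R]_12 :=
  [set J | V (jet_pt J) /\
     pairwise_indep (fun i => pullback1 psi (w i) (jet_pt J)
                              *m (jet_tangent J)^T)].

(* Main.v *)
(* On a hydrodynamic surface the eigenforms are multiples of psi_i = dx + v^i dt,
   and the forms (v^j - v^k) psi_i, for (i, j, k) cyclic, add up to zero.  They
   normalise the characteristic web, and an identity of rational functions shows
   that the connection form of this normalisation is exactly
   - Omega - (sum of the * Omega^i) / 2.  Another normalisation changes
   the connection form by a closed form dk / k, so the curvature is the exterior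
   derivative of this one.

   On an arbitrary graph, weights c_i with c_0 th_0 + c_1 th_1 + c_2 th_2 = 0
   normalise the web, and the connection form depends on the 2-jet.  The defect
   in the equation is thus a total exterior derivative, affine in the third
   derivatives.  Its symbol is the product of the characteristic directions,
   times the determinant of the coframe, divided by c_0 c_1 c_2. *)
Require Import Defs.
From mathcomp Require Import all_boot all_order all_algebra.
From mathcomp Require Import all_classical all_reals all_analysis.
From mathcomp Require Import ring zify.

Import Order.TTheory GRing.Theory Num.Theory.
Import numFieldNormedType.Exports.

Local Open Scope classical_set_scope.
Local Open Scope ring_scope.

Set Implicit Arguments.
Unset Strict Implicit.
Unset Printing Implicit Defensive.

(** * Partial derivatives and smooth functions *)

(** One function F has to serve all graphs at once. An arbitrary graph carries no functions x and t,
    so its normalisation is built from the restricted eigenforms alone: the weights are the areas of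
    th_(i+1) and th_(i+2), and the linear relation is Cramer's rule. All ingredients then become
    smooth functions of the jet, and the exterior derivative along a graph becomes a difference of
    total derivatives.

    The coefficient of Omega^i is the one for which the relation between the psi_i gives, with w_i =
    l_i psi_i on the surface, * Omega^i = - v^i_i l_i (psi_j / (v^i - v^j) + psi_k / (v^i - v^k)).

    The order is exactly three because the cubic symbol has three distinct roots and a nonzero
    factor (eigenforms of distinct eigenvalues form a coframe). If its coefficients at f_000 and
    f_001 both vanished, the symbol would have a double root; hence only these two coefficients are
    computed. *)

Section DifferentiableEps.
Variables (R : realType) (V W : normedModType R).
Implicit Types (f : V -> W) (p : V).

Lemma differentiable_eps f p : differentiable f p -> forall e : R, 0 < e ->
  \forall h \near (0 : V), `|f (h + p) - f p - 'd f p h| <= e * `|h|.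
Proof.
move=> /diff_locally/eqaddoP df e e0; have := df e e0.
by apply: filterS => h /=; rewrite opprD addrA.
Qed.

Lemma differentiable_epsP (L : {linear V -> W}) f p : continuous L ->
  (forall e : R, 0 < e ->
    \forall h \near (0 : V), `|f (h + p) - f p - L h| <= e * `|h|) ->
  differentiable f p.
Proof.
move=> cL h.
have e : f \o shift p = cst (f p) + L +o_ (nbhs (0 : V)) id.
  apply/eqaddoP => e /h; apply: filterS => x /=.
  by rewrite opprD addrA.
have dL := diff_unique cL e.
by apply/diff_locallyP; rewrite dL.
Qed.
Lemma near_translate p (U : set V) : nbhs p U ->
  \forall h \near (0 : V), U (h + p).
Proof.
move=> nU; suff c : (h + p) @[h --> (0 : V)] --> p by exact: c.
rewrite -[X in _ --> X]add0r.
by apply: cvgD; [apply: cvg_id|apply: cvg_cst].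
Qed.

(** Functions are total but only their values on an open set matter, so differentiability has to
    pass between functions that agree near p. *)
Lemma near_eq_differentiable f g p : {near p, f =1 g} ->
  differentiable f p -> differentiable g p.
Proof.
move=> fg df; apply: (@differentiable_epsP ('d f p)).
  exact: diff_continuous.
move=> e e0; have He := differentiable_eps df e0.
move: He (near_translate fg); apply: filterS2 => h He HU.
by rewrite -HU -(nbhs_singleton fg).
Qed.
End DifferentiableEps.

Section PartialDerivatives.
Variables (R : realType) (n : nat).
Implicit Types (f g : 'rV[R]_n -> R) (U : set 'rV[R]_n) (p : 'rV[R]_n).
Implicit Type a : 'I_n.

Lemma pderivE a f p : differentiable f p ->
  pderiv a f p = 'd f p (delta_mx 0 a).
Proof. by move=> df; rewrite /pderiv deriveE. Qed.

Lemma open_near U p (P : 'rV[R]_n -> Prop) : open U -> U p ->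
  (forall q, U q -> P q) -> \forall q \near p, P q.
Proof. by move=> oU Up h; apply: filterS h _; exact: open_nbhs_nbhs. Qed.

Lemma eq_pderiv a U f g p : open U -> U p -> (forall q, U q -> f q = g q) ->
  pderiv a f p = pderiv a g p.
Proof. by move=> oU Up fg; apply: near_eq_derive; exact: open_near fg. Qed.

Lemma eq_foldr_pderiv (s : seq 'I_n) U f g p : open U ->
  (forall q, U q -> f q = g q) -> U p ->
  foldr (@pderiv R n) f s p = foldr (@pderiv R n) g s p.
Proof.
move=> oU fg; elim: s p => [|a s IH] p Up /=; first exact: fg.
exact: (eq_pderiv _ oU).
Qed.

Lemma eq_differentiable U f g p : open U -> U p ->
  (forall q, U q -> f q = g q) -> differentiable f p -> differentiable g p.
Proof.
by move=> oU Up fg; apply: near_eq_differentiable; exact: open_near fg.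
Qed.

Lemma pderiv_cst a (c : R) p : pderiv a (fun=> c) p = 0.
Proof. exact: derive_cst. Qed.

Lemma pderivD a f g p : differentiable f p -> differentiable g p ->
  pderiv a (fun q => f q + g q) p = pderiv a f p + pderiv a g p.
Proof. by move=> df dg; rewrite /pderiv deriveD//; exact: diff_derivable. Qed.

Lemma pderivB a f g p : differentiable f p -> differentiable g p ->
  pderiv a (fun q => f q - g q) p = pderiv a f p - pderiv a g p.
Proof. by move=> df dg; rewrite /pderiv deriveB//; exact: diff_derivable. Qed.

Lemma pderivN a f p : differentiable f p ->
  pderiv a (fun q => - f q) p = - pderiv a f p.
Proof. by move=> df; rewrite /pderiv deriveN//; exact: diff_derivable. Qed.

Lemma pderivM a f g p : differentiable f p -> differentiable g p ->
  pderiv a (fun q => f q * g q) p = f p * pderiv a g p + g p * pderiv a f p.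
Proof. by move=> df dg; rewrite /pderiv deriveM//; exact: diff_derivable. Qed.

Lemma pderivV a f p : differentiable f p -> f p != 0 ->
  pderiv a (fun q => (f q)^-1) p = - ((f p)^-1 * (f p)^-1 * pderiv a f p).
Proof.
move=> df f0; rewrite /pderiv deriveV//; last exact: diff_derivable.
by rewrite -exprVn expr2 scaleNr.
Qed.

Lemma pderiv_sum (m : nat) a (F : 'I_m -> 'rV[R]_n -> R) p :
  (forall i, differentiable (F i) p) ->
  pderiv a (fun q => \sum_i F i q) p = \sum_i pderiv a (F i) p.
Proof.
move=> dF; rewrite /pderiv -derive_sum; last by move=> i; exact: diff_derivable.
by congr ('D_ _ _ p); apply/funext => q; rewrite fct_sumE.
Qed.

Lemma pderiv_coord a b p : pderiv a (fun q : 'rV[R]_n => q 0 b) p = (a == b)%:R.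
Proof.
have di : derivable (id : 'rV[R]_n -> 'rV[R]_n) p (delta_mx 0 a).
  exact: derivable_id.
have := derive_mx di.
by rewrite derive_id => /matrixP/(_ 0 b); rewrite !mxE eqxx /= eq_sym.
Qed.
End PartialDerivatives.

(** * Symmetry of second derivatives *)

Section Schwarz.
Variables (R : realType) (V : normedModType R).
Implicit Types (f : V -> R) (p a b : V).

Lemma is_derive_line f p a (t : R) : derivable f (t *: a + p) a ->
  is_derive t 1 (fun s : R => f (s *: a + p)) ('D_a f (t *: a + p)).
Proof.
move=> df.
have e : (fun h : R => h^-1 *: (((fun s : R => f (s *: a + p)) \o shift t) (h *: 1)
    - f (t *: a + p))) =
    (fun h : R => h^-1 *: ((f \o shift (t *: a + p)) (h *: a) - f (t *: a + p))).
  apply/funext => h /=.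
  by rewrite [h *: 1]mulr1 scalerDl addrA.
by split; rewrite /derivable /derive e.
Qed.

(** By the mean value theorem in the direction a, the second difference is h times an increment of
    ['D_a f] in the direction h b. Differentiability of ['D_a f] at the single point p estimates
    that increment up to o(h), without continuity of second derivatives. *)
Lemma second_difference f p a b (l : R) :
  (\forall q \near p, differentiable f q) -> differentiable ('D_a f) p ->
  'D_b ('D_a f) p = l ->
  forall e : R, 0 < e -> exists2 d : R, 0 < d & forall h : R, 0 < h -> h < d ->
  `|f (h *: a + (h *: b + p)) - f (h *: a + p) - f (h *: b + p) + f p
    - h ^+ 2 * l| <= e * h ^+ 2.
Proof.
move=> nf dG; rewrite deriveE// => <- e e0.
set G := 'D_a f; set c := `|a| + `|b|.
have c0 : 0 <= c by rewrite addr_ge0.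
have c1 : 0 < 2 * c + 1 by rewrite ltr_wpDl// mulr_ge0.
have [d1 d10 Hd1] := (nbhs_ballP _ _).1 (near_translate nf).
(* Two errors, each at most this constant times h c, will be added; the summand 1 keeps the
   denominator positive when a and b vanish. *)
have e'0 : 0 < e / (2 * c + 1) by rewrite divr_gt0.
have [d2 d20 Hd2] := (nbhs_ballP _ _).1 (differentiable_eps dG e'0).
pose d := Num.min d1 d2 / (c + 1).
have c2 : 0 < c + 1 by rewrite ltr_wpDl.
exists d; first by rewrite divr_gt0// lt_min; apply/andP.
move=> h h0; rewrite ltr_pdivlMr// lt_min => /andP[hd1 hd2].
have small (s : R) (t : R) : 0 <= s -> s <= h -> 0 <= t -> t <= h ->
    `|s *: a + t *: b| <= h * c.
  move=> s0 sh t0 th; rewrite (le_trans (ler_normD _ _))// !normrZ.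
  by rewrite !ger0_norm// mulrDr lerD// ler_wpM2r.
have hc : h * c < h * (c + 1) by rewrite ltr_pM2l// ltrDl.
have diffn (s t : R) : 0 <= s -> s <= h -> 0 <= t -> t <= h ->
    differentiable f (s *: a + t *: b + p).
  move=> s0 sh t0 th; apply: Hd1.
  rewrite -ball_normE /= sub0r normrN (le_lt_trans (small _ _ s0 sh t0 th))//.
  exact: lt_trans hc hd1.
have estn (s t : R) : 0 <= s -> s <= h -> 0 <= t -> t <= h ->
    `|G (s *: a + t *: b + p) - G p - (s * 'd G p a + t * 'd G p b)|
      <= e / (2 * c + 1) * (h * c).
  move=> s0 sh t0 th.
  have -> : s * 'd G p a + t * 'd G p b = 'd G p (s *: a + t *: b).
    by rewrite linearD !linearZ.
  have := Hd2 (s *: a + t *: b); rewrite -ball_normE /= sub0r normrN => H.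
  have sm := small _ _ s0 sh t0 th.
  apply: (le_trans (H _)); last by rewrite ler_wpM2l// ltW.
  exact: le_lt_trans sm (lt_trans hc hd2).
(* The second difference is phi(h) - phi(0), which the mean value theorem rewrites as h phi'(s). *)
pose phi := fun s : R => f (s *: a + (h *: b + p)) - f (s *: a + p).
pose dphi := fun s : R => G (s *: a + (h *: b + p)) - G (s *: a + p).
have dp (s : R) : 0 <= s -> s <= h -> is_derive s (1 : R) phi (dphi s).
  move=> s0 sh; apply: is_deriveB; apply: is_derive_line; apply: diff_derivable.
    by rewrite addrA; exact: diffn (ltW h0) _.
  by have := diffn s 0 s0 sh (lexx _) (ltW h0); rewrite scale0r addr0.
have [||s] := @MVT R phi dphi 0 h h0.
- move=> s; rewrite in_itv /= => /andP[s0 sh].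
  by apply: dp; exact: ltW.
- apply: derivable_within_continuous => s; rewrite in_itv /= => /andP[s0 sh].
  by have [] := dp s s0 sh.
rewrite in_itv /= => /andP[s0 sh]; rewrite /phi scale0r !add0r subr0 => Eq.
have {Eq} -> : f (h *: a + (h *: b + p)) - f (h *: a + p) - f (h *: b + p) + f p
    = dphi s * h by rewrite -Eq; ring.
have E1 := estn s h (ltW s0) (ltW sh) (ltW h0) (lexx h).
have E2 := estn s 0 (ltW s0) (ltW sh) (lexx 0) (ltW h0).
rewrite scale0r addr0 mul0r addr0 in E2.
have -> : dphi s * h - h ^+ 2 * 'd G p b =
   h * ((G (s *: a + h *: b + p) - G p - (s * 'd G p a + h * 'd G p b))
        - (G (s *: a + p) - G p - s * 'd G p a)).
  by rewrite /dphi addrA; ring.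
rewrite normrM gtr0_norm// expr2 [e * _]mulrCA ler_pM2l//.
apply: (le_trans (ler_normB _ _)); apply: (le_trans (lerD E1 E2)).
have -> : e / (2 * c + 1) * (h * c) + e / (2 * c + 1) * (h * c) =
    e * (h * (2 * c / (2 * c + 1))).
  by field; rewrite gt_eqF.
rewrite ler_pM2l//; apply: ler_piMr; first exact: ltW.
by rewrite ler_pdivrMr// mul1r lerDl.
Qed.

(** The second difference is symmetric in a and b, so both iterated derivatives are approximated by
    the same quantity divided by h^2. *)
Lemma Schwarz f p a b :
  (\forall q \near p, differentiable f q) ->
  differentiable ('D_a f) p -> differentiable ('D_b f) p ->
  'D_a ('D_b f) p = 'D_b ('D_a f) p.
Proof.
move=> nf da db.
move EX : ('D_a ('D_b f) p) => X; move EY : ('D_b ('D_a f) p) => Y.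
apply/eqP; rewrite -subr_eq0 -normr_eq0; apply/eqP/le_anti.
rewrite normr_ge0 andbT; apply/ler_addgt0Pl => e e0.
rewrite addr0.
have e20 : 0 < e / 2 by rewrite divr_gt0.
have [d1 d10 H1] := second_difference nf da EY e20.
have [d2 d20 H2] := second_difference nf db EX e20.
pose h := Num.min d1 d2 / 2.
have m0 : 0 < Num.min d1 d2 by rewrite lt_min d10.
have h0 : 0 < h by rewrite divr_gt0.
have hm : h < Num.min d1 d2 by rewrite ltr_pdivrMr// ltr_pMr// ltr1n.
move: hm; rewrite lt_min => /andP[hd1 hd2].
have := H1 h h0 hd1; have := H2 h h0 hd2.
have -> : h *: b + (h *: a + p) = h *: a + (h *: b + p) by rewrite addrCA.
set D := f (h *: a + (h *: b + p)) => K1 K2.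
have h20 : 0 < h ^+ 2 by rewrite exprn_gt0.
rewrite -(ler_pM2l h20) -{1}(gtr0_norm h20) -normrM.
have -> : h ^+ 2 * (X - Y) =
  (D - f (h *: a + p) - f (h *: b + p) + f p - h ^+ 2 * Y) -
  (D - f (h *: b + p) - f (h *: a + p) + f p - h ^+ 2 * X) by ring.
apply: (le_trans (ler_normB _ _)); apply: (le_trans (lerD K2 K1)).
by rewrite -mulrDl -splitr mulrC.
Qed.

End Schwarz.

Section ChainRule.
Variable R : realType.

Lemma differentiable_row (m n : nat) (g : 'rV[R]_n -> 'rV[R]_m) p :
  (forall j, differentiable (fun q => g q 0 j) p) -> differentiable g p.
Proof.
move=> dg.
have -> : g = \sum_(j < m) (fun q => g q 0 j *: (delta_mx 0 j : 'rV[R]_m)).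
  by apply/funext => q; rewrite fct_sumE [LHS]row_sum_delta.
apply: differentiable_sum => j.
exact: (@differentiableZl _ _ _ (fun q => g q 0 j)).
Qed.

Lemma diff_row (m n : nat) (g : 'rV[R]_n -> 'rV[R]_m) p a :
  (forall j, differentiable (fun q => g q 0 j) p) ->
  'd g p (delta_mx 0 a) = \row_j pderiv a (fun q => g q 0 j) p.
Proof.
move=> dg; have Dg := differentiable_row dg.
rewrite -deriveE// derive_mx; last exact: diff_derivable.
by apply/rowP => j; rewrite !mxE.
Qed.

Lemma jacobianE (m n : nat) (g : 'rV[R]_n -> 'rV[R]_m) p a j :
  (forall j, differentiable (fun q => g q 0 j) p) ->
  jacobian g p a j = pderiv a (fun q => g q 0 j) p.
Proof.
move=> dg; have := diff_row a dg.
by rewrite -[X in X = _]mul_rV_lin1 -rowE => /rowP/(_ j); rewrite !mxE => <-.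
Qed.

Lemma differentiable_row_comp (m n : nat) (f : 'rV[R]_m -> R)
    (g : 'rV[R]_n -> 'rV[R]_m) p :
  differentiable f (g p) -> (forall j, differentiable (fun q => g q 0 j) p) ->
  differentiable (fun q => f (g q)) p.
Proof.
by move=> df dg; apply: differentiable_comp => //; exact: differentiable_row.
Qed.

Lemma pderiv_comp (m n : nat) (f : 'rV[R]_m -> R) (g : 'rV[R]_n -> 'rV[R]_m)
    p a :
  differentiable f (g p) -> (forall j, differentiable (fun q => g q 0 j) p) ->
  pderiv a (fun q => f (g q)) p =
  \sum_j pderiv j f (g p) * pderiv a (fun q => g q 0 j) p.
Proof.
move=> df dg; rewrite pderivE; last exact: differentiable_row_comp.
rewrite (diff_comp (differentiable_row dg) df) /= diff_row//.
rewrite [X in 'd f _ X]row_sum_delta linear_sum /=; apply: eq_bigr => j _.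
by rewrite linearZ /= mxE (pderivE _ df) [RHS]mulrC.
Qed.

End ChainRule.

(** * Closure properties of smooth functions *)

Section SmoothFunctions.
Variable R : realType.

Lemma smooth_diff (n : nat) (U : set 'rV[R]_n) f p :
  smooth U f -> U p -> differentiable f p.
Proof. by move=> /(_ [::]); apply. Qed.

Lemma smooth_pderiv (n : nat) (U : set 'rV[R]_n) f a :
  smooth U f -> smooth U (pderiv a f).
Proof. by move=> sf s p Up; rewrite -foldr_rcons; exact: sf. Qed.

Lemma smoothS (n : nat) (U V : set 'rV[R]_n) f :
  V `<=` U -> smooth U f -> smooth V f.
Proof. by move=> VU sf s p /VU; exact: sf. Qed.

Lemma smooth_Schwarz (n : nat) (U : set 'rV[R]_n) f a b p : open U ->
  smooth U f -> U p -> pderiv a (pderiv b f) p = pderiv b (pderiv a f) p.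
Proof.
move=> oU sf Up; apply: Schwarz.
- by apply: (open_near oU Up) => q; exact: smooth_diff.
- exact: (smooth_diff (smooth_pderiv a sf)).
- exact: (smooth_diff (smooth_pderiv b sf)).
Qed.

(* This class is stable under partial differentiation by construction, so a
   single structural induction gives all the closure properties of [smooth]. *)
Inductive smooth_expr (n : nat) (U : set 'rV[R]_n) : ('rV[R]_n -> R) -> Prop :=
| SmoothBase f : smooth U f -> smooth_expr U f
| SmoothComp m (V : set 'rV[R]_m) f (g : 'rV[R]_n -> 'rV[R]_m) :
    smooth V f -> (forall j, smooth U (fun q => g q 0 j)) ->
    (forall q, U q -> V (g q)) -> smooth_expr U (fun q => f (g q))
| SmoothCst c : smooth_expr U (fun=> c)
| SmoothCoord i : smooth_expr U (fun q => q 0 i)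
| SmoothAdd f g : smooth_expr U f -> smooth_expr U g ->
    smooth_expr U (fun q => f q + g q)
| SmoothMul f g : smooth_expr U f -> smooth_expr U g ->
    smooth_expr U (fun q => f q * g q)
| SmoothInv f : smooth_expr U f -> (forall q, U q -> f q != 0) ->
    smooth_expr U (fun q => (f q)^-1).

Lemma smooth_expr_diff (n : nat) (U : set 'rV[R]_n) f p :
  smooth_expr U f -> U p -> differentiable f p.
Proof.
move=> ef Up; elim: ef => {f}.
- by move=> f sf; exact: smooth_diff Up.
- move=> m V f g sf sg UV; apply: differentiable_row_comp.
    exact: (smooth_diff sf (UV _ Up)).
  by move=> j; exact: (smooth_diff (sg j)).
- by move=> c; exact: differentiable_cst.
- by move=> i; exact: differentiable_coord.
- by move=> f g _ df _ dg; exact: differentiableD.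
- by move=> f g _ df _ dg; exact: differentiableM.
- by move=> f _ df f0; apply: differentiableV => //; exact: f0.
Qed.

Lemma smooth_expr_sum (n m : nat) (U : set 'rV[R]_n)
    (F : 'I_m -> 'rV[R]_n -> R) :
  (forall i, smooth_expr U (F i)) -> smooth_expr U (fun q => \sum_i F i q).
Proof.
move=> sF; elim: (index_enum 'I_m) => [|i s IH].
  rewrite (_ : (fun q => _) = fun=> 0); first exact: SmoothCst.
  by apply/funext => q; rewrite big_nil.
rewrite (_ : (fun q => _) = fun q => F i q + \sum_(j <- s) F j q).
  exact: SmoothAdd.
by apply/funext => q; rewrite big_cons.
Qed.

Lemma smooth_expr_pderiv (n : nat) (U : set 'rV[R]_n) f a : smooth_expr U f ->
  exists2 g, smooth_expr U g & forall p, U p -> pderiv a f p = g p.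
Proof.
elim=> {f}.
- move=> f sf; exists (pderiv a f) => //.
  by apply: SmoothBase; exact: smooth_pderiv.
- move=> m V f g sf sg UV.
  exists (fun q => \sum_j pderiv j f (g q) * pderiv a (fun q => g q 0 j) q).
    apply: smooth_expr_sum => j; apply: SmoothMul.
      by apply: SmoothComp UV; [exact: smooth_pderiv|].
    by apply: SmoothBase; exact: smooth_pderiv.
  move=> p Up; apply: pderiv_comp; first exact: (smooth_diff sf (UV _ Up)).
  by move=> j; exact: (smooth_diff (sg j)).
- by move=> c; exists (fun=> 0); [exact: SmoothCst|move=> p _; exact: pderiv_cst].
- move=> i; exists (fun=> (a == i)%:R); first exact: SmoothCst.
  by move=> p _; exact: pderiv_coord.
- move=> f g ef [f' ef' df] eg [g' eg' dg].
  exists (fun q => f' q + g' q); first exact: SmoothAdd.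
  by move=> p Up; rewrite pderivD ?df ?dg//; exact: smooth_expr_diff Up.
- move=> f g ef [f' ef' df] eg [g' eg' dg].
  exists (fun q => f q * g' q + g q * f' q).
    by apply: SmoothAdd; exact: SmoothMul.
  by move=> p Up; rewrite pderivM ?df ?dg//; exact: smooth_expr_diff Up.
- move=> f ef [f' ef' df] f0.
  exists (fun q => -1 * ((f q)^-1 * (f q)^-1 * f' q)).
    do ?apply: SmoothMul => //; [exact: SmoothCst|exact: SmoothInv..].
  move=> p Up; rewrite pderivV ?df ?mulN1r//; last exact: f0.
  exact: smooth_expr_diff Up.
Qed.

(** [foldr] applies the last index of the list first, so the induction peels the list from its end:
    the first derivative taken is again an expression of the class, on U. *)
Lemma smooth_expr_smooth (n : nat) (U : set 'rV[R]_n) f : open U ->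
  smooth_expr U f -> smooth U f.
Proof.
move=> oU + s; elim/last_ind: s f => [|s a IH] f ef p Up /=.
  exact: smooth_expr_diff Up.
rewrite foldr_rcons; have [g eg fg] := smooth_expr_pderiv a ef.
apply: (eq_differentiable oU Up) (IH g eg p Up) => q Uq.
by apply: (eq_foldr_pderiv _ oU) => // r Ur; rewrite fg.
Qed.

Section Closure.
Variables (n : nat) (U : set 'rV[R]_n).
Hypothesis oU : open U.
Implicit Types f g : 'rV[R]_n -> R.

Lemma eq_smooth f g : (forall p, U p -> f p = g p) -> smooth U f -> smooth U g.
Proof.
move=> fg sf s p Up; apply: (eq_differentiable oU Up) (sf s p Up) => q Uq.
exact: (eq_foldr_pderiv _ oU).
Qed.

Lemma smooth_cst (c : R) : smooth U (fun=> c).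
Proof. by apply: smooth_expr_smooth => //; exact: SmoothCst. Qed.

Lemma smooth_coord i : smooth U (fun q => q 0 i).
Proof. by apply: smooth_expr_smooth => //; exact: SmoothCoord. Qed.

Lemma smoothD f g : smooth U f -> smooth U g -> smooth U (fun q => f q + g q).
Proof.
move=> sf sg; apply: smooth_expr_smooth => //.
by apply: SmoothAdd; exact: SmoothBase.
Qed.

Lemma smoothM f g : smooth U f -> smooth U g -> smooth U (fun q => f q * g q).
Proof.
move=> sf sg; apply: smooth_expr_smooth => //.
by apply: SmoothMul; exact: SmoothBase.
Qed.

Lemma smoothV f : smooth U f -> (forall q, U q -> f q != 0) ->
  smooth U (fun q => (f q)^-1).
Proof.
move=> sf f0; apply: smooth_expr_smooth => //.
by apply: SmoothInv => //; exact: SmoothBase.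
Qed.

Lemma smoothN f : smooth U f -> smooth U (fun q => - f q).
Proof.
move=> sf; apply: (@eq_smooth (fun q => -1 * f q)) => [p _|].
  by rewrite mulN1r.
by apply: smoothM => //; exact: smooth_cst.
Qed.

Lemma smoothB f g : smooth U f -> smooth U g -> smooth U (fun q => f q - g q).
Proof. by move=> sf sg; apply: smoothD => //; exact: smoothN. Qed.

Lemma smooth_sum (I : Type) (s : seq I) (P : pred I) (F : I -> 'rV[R]_n -> R) :
  (forall i, smooth U (F i)) -> smooth U (fun q => \sum_(i <- s | P i) F i q).
Proof.
move=> sF; elim: s => [|i s IH].
  rewrite (_ : (fun q => _) = fun=> 0); first exact: smooth_cst.
  by apply/funext => q; rewrite big_nil.
rewrite (_ : (fun q => _) =
  fun q => (P i)%:R * F i q + \sum_(j <- s | P j) F j q).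
  by apply: smoothD => //; apply: smoothM => //; exact: smooth_cst.
by apply/funext => q; rewrite big_cons; case: (P i); rewrite ?mul1r// mul0r add0r.
Qed.

Lemma smooth_prod (I : Type) (s : seq I) (F : I -> 'rV[R]_n -> R) :
  (forall i, smooth U (F i)) -> smooth U (fun q => \prod_(i <- s) F i q).
Proof.
move=> sF; elim: s => [|i s IH].
  rewrite (_ : (fun q => _) = fun=> 1); first exact: smooth_cst.
  by apply/funext => q; rewrite big_nil.
rewrite (_ : (fun q => _) = fun q => F i q * \prod_(j <- s) F j q).
  exact: smoothM.
by apply/funext => q; rewrite big_cons.
Qed.

Lemma smooth_comp (m : nat) (V : set 'rV[R]_m) (f : 'rV[R]_m -> R)
    (g : 'rV[R]_n -> 'rV[R]_m) :
  smooth V f -> (forall j, smooth U (fun q => g q 0 j)) ->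
  (forall q, U q -> V (g q)) -> smooth U (fun q => f (g q)).
Proof.
by move=> sf sg UV; apply: smooth_expr_smooth => //; exact: SmoothComp UV.
Qed.

Lemma smooth_det (m : nat) (M : 'rV[R]_n -> 'M[R]_m) :
  smooth_mx U M -> smooth U (fun q => \det (M q)).
Proof.
move=> sM; apply: smooth_sum => s; apply: smoothM; first exact: smooth_cst.
by apply: smooth_prod => i; exact: sM.
Qed.

Lemma smooth_mulmx (m k l : nat) (M : 'rV[R]_n -> 'M[R]_(m, k))
    (N : 'rV[R]_n -> 'M[R]_(k, l)) :
  smooth_mx U M -> smooth_mx U N -> smooth_mx U (fun q => M q *m N q).
Proof.
move=> sM sN i j; rewrite (_ : (fun p => _) = fun p => \sum_r M p i r * N p r j).
  by apply: smooth_sum => r; apply: smoothM; [exact: sM|exact: sN].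
by apply/funext => p; rewrite mxE.
Qed.

Lemma smooth_trmx (m k : nat) (M : 'rV[R]_n -> 'M[R]_(m, k)) :
  smooth_mx U M -> smooth_mx U (fun q => (M q)^T).
Proof.
move=> sM i j; rewrite (_ : (fun p => _) = fun p => M p j i); first exact: sM.
by apply/funext => p; rewrite mxE.
Qed.

Lemma smooth_invmx (m : nat) (M : 'rV[R]_n -> 'M[R]_m) :
  smooth_mx U M -> (forall q, U q -> M q \in unitmx) ->
  smooth_mx U (fun q => invmx (M q)).
Proof.
move=> sM uM i j.
(* The cofactor formula; it agrees with [invmx] only where the matrix is invertible, that is on
   U. *)
apply: (@eq_smooth (fun q => (\det (M q))^-1 * cofactor (M q) j i)).
  by move=> q Uq; rewrite /invmx uM// !mxE.
apply: smoothM.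
  apply: smoothV; first exact: smooth_det.
  by move=> q /uM; rewrite unitmxE unitfE.
apply: smoothM; first exact: smooth_cst.
apply: smooth_det => k l.
rewrite (_ : (fun p => _) = fun p => M p (lift j k) (lift i l)); first exact: sM.
by apply/funext => p; rewrite !mxE.
Qed.

Lemma smooth_jacobian (m : nat) (g : 'rV[R]_n -> 'rV[R]_m) :
  smooth_mx U g -> smooth_mx U (jacobian g).
Proof.
move=> sg a j; apply: (@eq_smooth (pderiv a (fun q => g q 0 j))).
  by move=> p Up; rewrite jacobianE// => k; exact: (smooth_diff (sg 0 k)).
by apply: smooth_pderiv; exact: sg.
Qed.

Lemma smooth_mx_comp (m k l : nat) (V : set 'rV[R]_m)
    (f : 'rV[R]_m -> 'M[R]_(k, l)) (g : 'rV[R]_n -> 'rV[R]_m) :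
  smooth_mx V f -> smooth_mx U g -> (forall q, U q -> V (g q)) ->
  smooth_mx U (fun q => f (g q)).
Proof. by move=> sf sg UV i j; apply: (smooth_comp (sf i j) (sg 0) UV). Qed.

Lemma smooth_pullback1 (m : nat) (V : set 'rV[R]_m) (g : 'rV[R]_n -> 'rV[R]_m)
    (w : 'rV[R]_m -> 'rV[R]_m) :
  smooth_mx V w -> smooth_mx U g -> (forall q, U q -> V (g q)) ->
  smooth_mx U (pullback1 g w).
Proof.
move=> sw sg UV; apply: smooth_mulmx; first exact: smooth_mx_comp sw sg UV.
by apply: smooth_trmx; exact: smooth_jacobian.
Qed.

End Closure.
End SmoothFunctions.

(** * Exterior calculus *)

Lemma sum2E (V : nmodType) (F : 'I_2 -> V) : \sum_i F i = F 0 + F 1.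
Proof.
by rewrite !big_ord_recl big_ord0 addr0; congr (_ + F _); apply: val_inj.
Qed.

Lemma det2E (R : comPzRingType) (M : 'M[R]_2) :
  \det M = M 0 0 * M 1 1 - M 0 1 * M 1 0.
Proof.
rewrite (expand_det_row _ 0) sum2E /cofactor !det_mx11 !mxE /=.
rewrite expr0 mul1r expr1 mulN1r mulrN.
by congr (_ * M _ _ - _ * M _ _); apply: val_inj.
Qed.

Section PlaneForms.
Variable R : realType.
Implicit Types a b c e : 'rV[R]_2.

(** The coefficient of a /\ b. It turns identities of 2-forms of the plane into scalar ones, within
    reach of [ring] and [field]. *)
Definition area a b : R := a 0 0 * b 0 1 - a 0 1 * b 0 0.

Lemma ord2_ind (P : 'I_2 -> Prop) : P 0 -> P 1 -> forall i, P i.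
Proof.
move=> p0 p1 [[|[|//]] hi].
  by rewrite (_ : Ordinal hi = 0)//; exact: val_inj.
by rewrite (_ : Ordinal hi = 1)//; exact: val_inj.
Qed.

Lemma row2P a b : a 0 0 = b 0 0 -> a 0 1 = b 0 1 -> a = b.
Proof. by move=> h0 h1; apply/rowP; exact: ord2_ind. Qed.

Lemma areaDl a b c : area (a + b) c = area a c + area b c.
Proof. by rewrite /area !mxE; ring. Qed.

Lemma areaNl a c : area (- a) c = - area a c.
Proof. by rewrite /area !mxE; ring. Qed.

Lemma areaNr a c : area a (- c) = - area a c.
Proof. by rewrite /area !mxE; ring. Qed.

Lemma areaZl k a c : area (k *: a) c = k * area a c.
Proof. by rewrite /area !mxE; ring. Qed.

Lemma areaDr a b c : area c (a + b) = area c a + area c b.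
Proof. by rewrite /area !mxE; ring. Qed.

Lemma areaZr k a c : area c (k *: a) = k * area c a.
Proof. by rewrite /area !mxE; ring. Qed.

Lemma area_sym a b : area a b = - area b a.
Proof. by rewrite /area; ring. Qed.

Lemma area_self a : area a a = 0.
Proof. by rewrite /area; ring. Qed.

(** Cramer's rule: each component of c times [area a b] is a combination of [area c a] and
    [area c b]. *)
Lemma area_cancel a b c : area a b != 0 -> area c a = 0 -> area c b = 0 -> c = 0.
Proof.
rewrite /area => h h1 h2.
have e0 : c 0 0 * (a 0 0 * b 0 1 - a 0 1 * b 0 0) = 0.
  transitivity (a 0 0 * (c 0 0 * b 0 1 - c 0 1 * b 0 0)
    - b 0 0 * (c 0 0 * a 0 1 - c 0 1 * a 0 0)); first by ring.
  by rewrite h1 h2 !mulr0 subr0.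
have e1 : c 0 1 * (a 0 0 * b 0 1 - a 0 1 * b 0 0) = 0.
  transitivity (a 0 1 * (c 0 0 * b 0 1 - c 0 1 * b 0 0)
    - b 0 1 * (c 0 0 * a 0 1 - c 0 1 * a 0 0)); first by ring.
  by rewrite h1 h2 !mulr0 subr0.
by apply: row2P; rewrite !mxE; apply/eqP; [move/eqP: e0|move/eqP: e1];
  rewrite mulf_eq0 (negbTE h) orbF.
Qed.

(** A 1-form is determined by its wedge products with two independent forms; this gives the
    uniqueness of connection forms. *)
Lemma area_ext a b c e : area a b != 0 -> area c a = area e a ->
  area c b = area e b -> c = e.
Proof.
move=> h h1 h2; apply/eqP; rewrite -subr_eq0; apply/eqP.
by apply: (area_cancel h); rewrite areaDl areaNl ?h1 ?h2 subrr.
Qed.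

Lemma indep_area a b : row_free (col_mx a b) = (area a b != 0).
Proof.
rewrite row_free_unit unitmxE unitfE (det2E (col_mx a b)) /area.
have e0 j : col_mx a b 0 j = a 0 j.
  by rewrite -(col_mxEu a b); congr (col_mx a b _ _); apply: val_inj.
have e1 j : col_mx a b 1 j = b 0 j.
  by rewrite -(col_mxEd a b); congr (col_mx a b _ _); apply: val_inj.
by rewrite !e0 !e1.
Qed.

Lemma wedge01 a b : wedge a b 0 1 = area a b.
Proof. by rewrite /wedge /area !mxE !big_ord1 !mxE; ring. Qed.

Lemma ext_d01 (w : 'rV[R]_2 -> 'rV[R]_2) s :
  ext_d w s 0 1 = pderiv 0 (fun q => w q 0 1) s - pderiv 1 (fun q => w q 0 0) s.
Proof. by rewrite mxE. Qed.

Lemma wedge_alt (n : nat) (a b : 'rV[R]_n) : (wedge a b)^T = - wedge a b.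
Proof. by rewrite /wedge linearB /= !trmx_mul !trmxK opprB. Qed.

Lemma ext_d_alt (n : nat) (w : 'rV[R]_n -> 'rV[R]_n) s :
  (ext_d w s)^T = - ext_d w s.
Proof. by apply/matrixP => i j; rewrite !mxE opprB. Qed.

(** Reduces an equation between 2-forms of the plane to a single scalar equation. *)
Lemma eq_alt2 (A B : 'M[R]_2) :
  A^T = - A -> B^T = - B -> A 0 1 = B 0 1 -> A = B.
Proof.
move=> hA hB h.
have hd (C : 'M[R]_2) i : C^T = - C -> C i i = 0.
  move=> /matrixP/(_ i i); rewrite !mxE => /eqP.
  by rewrite -subr_eq0 opprK -mulr2n mulrn_eq0 /= => /eqP.
have ho (C : 'M[R]_2) : C^T = - C -> C 1 0 = - C 0 1.
  by move=> /matrixP/(_ 0 1); rewrite !mxE.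
apply/matrixP; apply: ord2_ind; apply: ord2_ind.
- by rewrite !hd.
- by [].
- by rewrite !ho// h.
- by rewrite !hd.
Qed.

(** If e = alpha a + beta b, the two areas are beta and alpha times [area a b], so the right side is
    beta b - alpha a. *)
Lemma hodgeE a b e : area a b != 0 ->
  hodge a b e = (area a b)^-1 *: (area a e *: b - area e b *: a).
Proof.
move=> h; rewrite /hodge.
set g := a^T *m b + b^T *m a; set X := e *m invmx g.
have ug : g \in unitmx.
  rewrite unitmxE unitfE det2E !mxE !big_ord1 !mxE.
  rewrite (_ : _ - _ = - (area a b) ^+ 2); last by rewrite /area; ring.
  by rewrite oppr_eq0 expf_neq0.
have Xg : X *m g = e by rewrite mulmxKV.
(* These are a(X) and b(X): the metric sends X to s b + t a, and the contraction of a /\ b with X is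
   s b - t a. *)
pose s := (X *m a^T) 0 0; pose t := (X *m b^T) 0 0.
have Xa : X *m a^T = s%:M by rewrite [LHS]mx11_scalar.
have Xb : X *m b^T = t%:M by rewrite [LHS]mx11_scalar.
have He : e = s *: b + t *: a.
  by rewrite -Xg mulmxDr !mulmxA Xa Xb !mul_scalar_mx.
rewrite /wedge mulmxBr !mulmxA Xa Xb !mul_scalar_mx He.
rewrite areaDl areaDr !areaZl !areaZr !area_self !mulr0 addr0 add0r.
rewrite scalerBr !scalerA; congr (_ *: _ - _ *: _).
  by rewrite mulrC mulfK.
by rewrite mulrC mulfK.
Qed.

End PlaneForms.

Section ExteriorDerivative.
Variable R : realType.

Lemma eq_ext_d (n : nat) (D : set 'rV[R]_n) (w w' : 'rV[R]_n -> 'rV[R]_n) s :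
  open D -> D s -> (forall q, D q -> w q = w' q) -> ext_d w s = ext_d w' s.
Proof.
move=> oD Ds ww; apply/matrixP => a b; rewrite !mxE.
by congr (_ - _); apply: (eq_pderiv _ oD) => // q Dq; rewrite ww.
Qed.

Lemma ext_dD (n : nat) (D : set 'rV[R]_n) (w w' : 'rV[R]_n -> 'rV[R]_n) s :
  smooth_mx D w -> smooth_mx D w' -> D s ->
  ext_d (fun q => w q + w' q) s = ext_d w s + ext_d w' s.
Proof.
move=> sw sw' Ds; apply/matrixP => a b; rewrite !mxE.
have E i j : pderiv i (fun q => (w q + w' q) 0 j) s =
    pderiv i (fun q => w q 0 j) s + pderiv i (fun q => w' q 0 j) s.
  rewrite -pderivD.
  - by congr (pderiv _ _ s); apply/funext => q; rewrite mxE.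
  - exact: (smooth_diff (sw 0 j)).
  - exact: (smooth_diff (sw' 0 j)).
by rewrite !E; ring.
Qed.

Lemma ext_dZ (D : set 'rV[R]_2) (f : 'rV[R]_2 -> R) (w : 'rV[R]_2 -> 'rV[R]_2) s :
  smooth D f -> smooth_mx D w -> D s ->
  ext_d (fun q => f q *: w q) s 0 1 = area (grad f s) (w s) + f s * ext_d w s 0 1.
Proof.
move=> sf sw Ds; rewrite !ext_d01 /area !mxE.
have E i j : pderiv i (fun q => (f q *: w q) 0 j) s =
    f s * pderiv i (fun q => w q 0 j) s + w s 0 j * pderiv i f s.
  rewrite -pderivM; last 2 first.
  - exact: smooth_diff sf Ds.
  - exact: (smooth_diff (sw 0 j)).
  by congr (pderiv _ _ s); apply/funext => q; rewrite mxE.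
by rewrite !E; ring.
Qed.

Lemma smooth_mxZ (n k m : nat) (U : set 'rV[R]_n) (f : 'rV[R]_n -> R)
    (M : 'rV[R]_n -> 'M[R]_(k, m)) : open U ->
  smooth U f -> smooth_mx U M -> smooth_mx U (fun q => f q *: M q).
Proof.
move=> oU sf sM i j; rewrite (_ : (fun p => _) = fun p => f p * M p i j).
  exact: (smoothM oU sf (sM i j)).
by apply/funext => p; rewrite mxE.
Qed.

Lemma smooth_mxD (n k m : nat) (U : set 'rV[R]_n)
    (M N : 'rV[R]_n -> 'M[R]_(k, m)) : open U ->
  smooth_mx U M -> smooth_mx U N -> smooth_mx U (fun q => M q + N q).
Proof.
move=> oU sM sN i j; rewrite (_ : (fun p => _) = fun p => M p i j + N p i j).
  exact: (smoothD oU (sM i j) (sN i j)).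
by apply/funext => p; rewrite mxE.
Qed.

Lemma smooth_mxN (n k m : nat) (U : set 'rV[R]_n)
    (M : 'rV[R]_n -> 'M[R]_(k, m)) : open U ->
  smooth_mx U M -> smooth_mx U (fun q => - M q).
Proof.
move=> oU sM i j; rewrite (_ : (fun p => _) = fun p => - M p i j).
  exact: (smoothN oU (sM i j)).
by apply/funext => p; rewrite mxE.
Qed.

Lemma smooth_mx_sum (n k m r : nat) (U : set 'rV[R]_n)
    (M : 'I_r -> 'rV[R]_n -> 'M[R]_(k, m)) : open U ->
  (forall l, smooth_mx U (M l)) -> smooth_mx U (fun q => \sum_l M l q).
Proof.
move=> oU sM i j; rewrite (_ : (fun p => _) = fun p => \sum_l M l p i j).
  by apply: smooth_sum => // l; exact: sM.
by apply/funext => p; rewrite summxE.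
Qed.

Lemma smooth_grad (n : nat) (U : set 'rV[R]_n) (f : 'rV[R]_n -> R) : open U ->
  smooth U f -> smooth_mx U (grad f).
Proof.
move=> oU sf i j; rewrite (_ : (fun p => _) = pderiv j f).
  exact: smooth_pderiv.
by apply/funext => p; rewrite mxE.
Qed.

Lemma smooth_area (n : nat) (U : set 'rV[R]_n) (a b : 'rV[R]_n -> 'rV[R]_2) :
  open U -> smooth_mx U a -> smooth_mx U b ->
  smooth U (fun q => area (a q) (b q)).
Proof.
by move=> oU sa sb; apply: smoothB => //; apply: smoothM => //;
  do ?[exact: sa|exact: sb].
Qed.

Lemma ext_d_grad (n : nat) (U : set 'rV[R]_n) (f : 'rV[R]_n -> R) s : open U ->
  smooth U f -> U s -> ext_d (grad f) s = 0.
Proof.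
move=> oU sf Us; apply/matrixP => i j; rewrite !mxE.
have E k : (fun q => grad f q 0 k) = pderiv k f.
  by apply/funext => q; rewrite mxE.
by rewrite !E (smooth_Schwarz _ _ oU sf Us) subrr.
Qed.

(** Since d(1/k) is a multiple of dk, its wedge product with dk vanishes; this avoids the logarithm
    and covers both signs of k. *)
Lemma ext_d_log_grad (D : set 'rV[R]_2) (k : 'rV[R]_2 -> R) s : open D ->
  smooth D k -> (forall s, D s -> k s != 0) -> D s ->
  ext_d (fun q => (k q)^-1 *: grad k q) s 0 1 = 0.
Proof.
move=> oD sk k0 Ds; rewrite (ext_dZ _ _ Ds); last 2 first.
- exact: smoothV.
- exact: smooth_grad.
rewrite (ext_d_grad oD sk Ds) mxE mulr0 addr0.
rewrite /area !mxE !pderivV ?k0//; try exact: smooth_diff sk Ds.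
by ring.
Qed.

(* The second derivatives of f cancel by Schwarz' theorem. *)
Lemma pullback_ext_d (n m : nat) (D : set 'rV[R]_n) (U : set 'rV[R]_m)
    (f : 'rV[R]_n -> 'rV[R]_m) (w : 'rV[R]_m -> 'rV[R]_m) s :
  open D -> open U -> smooth_mx D f -> (forall s, D s -> U (f s)) ->
  smooth_mx U w -> D s ->
  pullback2 f (ext_d w) s = ext_d (pullback1 f w) s.
Proof.
move=> oD oU sf DU sw Ds.
have Df q k : D q -> differentiable (fun r => f r 0 k) q.
  by move=> Dq; exact: (smooth_diff (sf 0 k)).
have E a b : pderiv a (fun q => pullback1 f w q 0 b) s =
    \sum_k ((w (f s) 0 k) * pderiv a (pderiv b (fun q => f q 0 k)) s
     + pderiv b (fun q => f q 0 k) s *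
       \sum_l pderiv l (fun q => w q 0 k) (f s) * pderiv a (fun q => f q 0 l) s).
  rewrite (@eq_pderiv _ _ a D _
    (fun q => \sum_k w (f q) 0 k * pderiv b (fun q => f q 0 k) q))//; last first.
    move=> q Dq; rewrite !mxE; apply: eq_bigr => k _.
    by rewrite mxE jacobianE// => j; exact: Df.
  have dw k : differentiable (fun q => w q 0 k) (f s).
    by apply: (smooth_diff (sw 0 k)); exact: DU.
  have dwf k : differentiable (fun q => w (f q) 0 k) s.
    apply: (differentiable_row_comp (f := fun q => w q 0 k)) => // j.
    exact: Df.
  have dpf k : differentiable (pderiv b (fun q => f q 0 k)) s.
    exact: (smooth_diff (smooth_pderiv b (sf 0 k))).
  rewrite pderiv_sum; last by move=> k; exact: differentiableM.
  apply: eq_bigr => k _; rewrite pderivM//; congr (_ + _ * _).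
  by rewrite (pderiv_comp (f := fun q => w q 0 k))// => j; exact: Df.
apply/matrixP => a b; rewrite [RHS]mxE !E -sumrB.
have Ja i j : jacobian f s i j = pderiv i (fun q => f q 0 j) s.
  by rewrite jacobianE// => k; exact: Df.
pose X a b k l := pderiv b (fun q => f q 0 k) s *
  (pderiv l (fun q => w q 0 k) (f s) * pderiv a (fun q => f q 0 l) s).
have S (F G : 'I_m -> 'I_m -> R) : \sum_k \sum_l (F k l - G k l) =
    \sum_k \sum_l F k l - \sum_k \sum_l G k l.
  by rewrite -sumrB; apply: eq_bigr => k _; rewrite sumrB.
rewrite (eq_bigr (fun k => \sum_l (X a b k l - X b a k l))).
  rewrite /pullback2 mxE.
  transitivity (\sum_k \sum_l (X a b k l - X b a l k)).
    apply: eq_bigr => k _; rewrite mxE [(_^T) _ _]mxE mulr_suml.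
    apply: eq_bigr => l _.
    by rewrite !Ja mxE /X; ring.
  by rewrite !S; congr (_ - _); rewrite exchange_big.
move=> k _; rewrite (smooth_Schwarz a b oD (sf 0 k) Ds) sumrB -!mulr_sumr.
by ring.
Qed.

Lemma pullback2_alt (n m : nat) (f : 'rV[R]_n -> 'rV[R]_m)
    (w : 'rV[R]_m -> 'rV[R]_m) s :
  (pullback2 f (ext_d w) s)^T = - pullback2 f (ext_d w) s.
Proof.
by rewrite /pullback2 !trmx_mul trmxK ext_d_alt mulNmx mulmxN mulmxA.
Qed.

End ExteriorDerivative.

(** * Plane 3-webs *)

Section Webs.
Variables (R : realType) (D : set 'rV[R]_2).
Hypothesis oD : open D.

(** The data hidden behind the existential quantifier of [web_curvature], named so that two choices
    can be compared. *)
Definition web_normalisation (th : 'I_3 -> 'rV[R]_2 -> 'rV[R]_2)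
    (ph1 ph2 ph : 'rV[R]_2 -> 'rV[R]_2) : Prop :=
  [/\ [/\ smooth_mx D ph1, smooth_mx D ph2 & smooth_mx D ph],
      forall s, D s -> [/\ proportional (ph1 s) (th 0 s),
                           proportional (ph2 s) (th 1 s) &
                           proportional (ph1 s - ph2 s) (th 2 s)] &
      forall s, D s -> ext_d ph1 s = wedge (ph s) (ph1 s)
                       /\ ext_d ph2 s = wedge (ph s) (ph2 s)].

Lemma proportional_quot (n : nat) (a b c : 'rV[R]_n) :
  proportional a c -> proportional b c -> exists2 k, k != 0 & b = k *: a.
Proof.
move=> [x x0 ->] [y y0 ->]; exists (y / x).
  by rewrite mulf_neq0// invr_neq0.
by rewrite scalerA divfK.
Qed.

(* Two normalisations differ by a factor k, and their connection forms by the
   closed form dk / k. *)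
Lemma web_normalisation_ext_d th p1 p2 p q1 q2 q :
  (forall s, D s -> pairwise_indep (th^~ s)) ->
  web_normalisation th p1 p2 p -> web_normalisation th q1 q2 q ->
  forall s, D s -> ext_d q s = ext_d p s.
Proof.
move=> ind [[sp1 sp2 sp] pp dp] [[sq1 sq2 sq] pq dq].
have np s : D s -> area (p1 s) (p2 s) != 0.
  move=> Ds; have [[a a0 ->] [b b0 ->] _] := pp s Ds.
  rewrite areaZl areaZr !mulf_neq0//.
  by have := ind s Ds 0 1 isT; rewrite indep_area.
(* The factor is written as a quotient of areas, which is smooth, rather than chosen point by point
   from the proportionalities. *)
pose k s := area (q1 s) (p2 s) / area (p1 s) (p2 s).
have kE s : D s -> [/\ k s != 0, q1 s = k s *: p1 s & q2 s = k s *: p2 s].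
  move=> Ds; have [pp0 pp1 pp2] := pp s Ds; have [pq0 pq1 pq2] := pq s Ds.
  have [x x0 ex] := proportional_quot pp0 pq0.
  have [y y0 ey] := proportional_quot pp1 pq1.
  have [z z0 ez] := proportional_quot pp2 pq2.
  have ek : k s = x by rewrite /k ex areaZl mulfK ?np.
  (* The third proportionality, wedged with p2 and with p1, forces both factors to agree with its
     own. *)
  have xz : x = z.
    have := congr1 (fun e => area e (p2 s)) ez.
    rewrite ex ey !(areaDl, areaZl, areaNl) !area_self mulr0 !oppr0 !addr0.
    exact: mulIf (np s Ds) _ _.
  have yz : y = z.
    have := congr1 (fun e => area (p1 s) e) ez.
    rewrite ex ey !(areaDr, areaZr, areaNr) !area_self mulr0 !add0r mulrN.
    by move=> /oppr_inj; exact: mulIf (np s Ds) _ _.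
  by rewrite ek ex ey xz yz.
have sk : smooth D k.
  apply: smoothM => //; first exact: smooth_area.
  by apply: smoothV => //; exact: smooth_area.
have k0 s (Ds : D s) : k s != 0 by have [] := kE s Ds.
(* From d(k p_i) = (p + dk / k) /\ k p_i for i = 1, 2, by uniqueness of the connection form. *)
have qE s : D s -> q s = p s + (k s)^-1 *: grad k s.
  move=> Ds; apply: (area_ext (np s Ds)).
    have := congr1 (fun M : 'M[R]_2 => M 0 1) (proj1 (dq s Ds)).
    rewrite /= (@eq_ext_d _ _ D _ (fun s => k s *: p1 s))//; last first.
      by move=> r Dr; have [] := kE r Dr.
    rewrite (ext_dZ sk sp1 Ds) (proj1 (dp s Ds)) !wedge01.
    have [_ -> _] := kE s Ds; rewrite areaZr areaDl areaZl => E.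
    apply: (mulfI (k0 s Ds)); rewrite -E [RHS]mulrDr (mulVKf (k0 s Ds)).
    by rewrite addrC.
  have := congr1 (fun M : 'M[R]_2 => M 0 1) (proj2 (dq s Ds)).
  rewrite /= (@eq_ext_d _ _ D _ (fun s => k s *: p2 s))//; last first.
    by move=> r Dr; have [] := kE r Dr.
  rewrite (ext_dZ sk sp2 Ds) (proj2 (dp s Ds)) !wedge01.
  have [_ _ ->] := kE s Ds; rewrite areaZr areaDl areaZl => E.
  apply: (mulfI (k0 s Ds)); rewrite -E [RHS]mulrDr (mulVKf (k0 s Ds)).
  by rewrite addrC.
have sl : smooth_mx D (fun s => (k s)^-1 *: grad k s).
  by apply: smooth_mxZ => //; [exact: smoothV|exact: smooth_grad].
move=> s Ds; rewrite (eq_ext_d oD Ds qE) (ext_dD sp sl Ds).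
rewrite [X in _ + X](_ : _ = 0) ?addr0//.
apply: eq_alt2; first exact: ext_d_alt.
  by rewrite trmx0 oppr0.
by rewrite (ext_d_log_grad oD sk k0 Ds) mxE.
Qed.

(** Any two normalisations have the same d of their connection forms, so a single explicit one
    decides which C is the curvature. *)
Lemma web_curvatureE th p1 p2 p C :
  (forall s, D s -> pairwise_indep (th^~ s)) -> web_normalisation th p1 p2 p ->
  web_curvature D th C <-> forall s, D s -> C s = ext_d p s.
Proof.
move=> ind np; split.
  move=> [q1 [q2 [q [sq pq dq CE]]]] s Ds; rewrite CE//.
  have nq : web_normalisation th q1 q2 q by split.
  exact: (web_normalisation_ext_d ind np nq).
by move=> CE; case: np => sp pp dp; exists p1, p2, p.
Qed.

End Webs.

Section WebConnection.
Variable R : realType.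
Implicit Types (D : set 'rV[R]_2) (th : 'I_3 -> 'rV[R]_2 -> 'rV[R]_2).

Lemma ord3_ind (P : 'I_3 -> Prop) : P 0 -> P 1 -> P 2 -> forall i, P i.
Proof.
move=> p0 p1 p2 [[|[|[|//]]] hi].
- by rewrite (_ : Ordinal hi = 0)//; exact: val_inj.
- by rewrite (_ : Ordinal hi = 1)//; exact: val_inj.
- by rewrite (_ : Ordinal hi = 2)//; exact: val_inj.
Qed.

Lemma ord3E : (((0 + 1)%R = 1%R :> 'I_3) * ((0 + 2)%R = 2%R :> 'I_3) *
  ((1 + 1)%R = 2%R :> 'I_3) * ((1 + 2)%R = 0%R :> 'I_3) *
  ((2 + 1)%R = 0%R :> 'I_3) * ((2 + 2)%R = 1%R :> 'I_3))%type.
Proof. by do !split; apply: val_inj. Qed.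

Lemma sum3E (V : nmodType) (F : 'I_3 -> V) : \sum_i F i = F 0 + F 1 + F 2.
Proof.
rewrite !big_ord_recl big_ord0 addr0 addrA.
by congr (F _ + F _ + F _); apply: val_inj.
Qed.

(** Cramer's rule: for pairwise independent covectors of the plane these are, up to a common factor,
    the only coefficients of a linear relation between the three. *)
Definition web_weight (th : 'I_3 -> 'rV[R]_2) (i : 'I_3) : R :=
  area (th (i + 1)) (th (i + 2)).

(* The form ph with [ph /\ c_i th_i = K_i dx /\ dt], which requires
   K_0 + K_1 + K_2 = 0. *)
Definition web_connection (th : 'I_3 -> 'rV[R]_2) (K : 'I_3 -> R) : 'rV[R]_2 :=
  let c := web_weight th in
  (c 0 * c 1 * c 2)^-1 *: ((K 1 * c 0) *: th 0 - (K 0 * c 1) *: th 1).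

Lemma web_weight_sum (th : 'I_3 -> 'rV[R]_2) :
  \sum_i web_weight th i *: th i = 0.
Proof.
rewrite sum3E /web_weight !ord3E.
by apply: row2P; rewrite !mxE /area; ring.
Qed.

Lemma web_weight_neq0 (th : 'I_3 -> 'rV[R]_2) i :
  pairwise_indep th -> web_weight th i != 0.
Proof.
move=> ind; rewrite /web_weight -indep_area; apply: ind.
by move: i; apply: ord3_ind.
Qed.

Lemma pairwise_indep_weight (th : 'I_3 -> 'rV[R]_2) :
  (forall i, web_weight th i != 0) -> pairwise_indep th.
Proof.
move=> h.
have h0 := h 0; have h1 := h 1; have h2 := h 2.
rewrite /web_weight !ord3E in h0 h1 h2.
have sw i j : area (th i) (th j) != 0 -> area (th j) (th i) != 0.
  by rewrite area_sym oppr_eq0.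
move=> i j ij; rewrite indep_area; move: i j ij.
by apply: ord3_ind; apply: ord3_ind => //= _; exact: sw.
Qed.

(** As c_0 th_0 + c_1 th_1 + c_2 th_2 = 0, the minus sign on the second form makes the difference of
    the two equal to - c_2 th_2. The wedge products prescribed with these two forms then fix the
    connection form. *)
Lemma web_connectionP D th : open D -> (forall i, smooth_mx D (th i)) ->
  (forall s, D s -> pairwise_indep (th^~ s)) ->
  web_normalisation D th
    (fun s => web_weight (th^~ s) 0 *: th 0 s)
    (fun s => - (web_weight (th^~ s) 1 *: th 1 s))
    (fun s => web_connection (th^~ s)
       (fun i => ext_d (fun q => web_weight (th^~ q) i *: th i q) s 0 1)).
Proof.
move=> oD sth ind.
have sc i : smooth D (fun s => web_weight (th^~ s) i) by exact: smooth_area.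
have c0 i s (Ds : D s) : web_weight (th^~ s) i != 0.
  exact: web_weight_neq0 (ind s Ds).
have sct i : smooth_mx D (fun s => web_weight (th^~ s) i *: th i s).
  exact: smooth_mxZ.
pose K s i := ext_d (fun q => web_weight (th^~ q) i *: th i q) s 0 1.
have sK i : smooth D (K^~ i).
  rewrite (_ : K^~ i = fun s =>
     pderiv 0 (fun q => (web_weight (th^~ q) i *: th i q) 0 1) s -
     pderiv 1 (fun q => (web_weight (th^~ q) i *: th i q) 0 0) s).
    by apply: smoothB => //; apply: smooth_pderiv; exact: sct.
  by apply/funext => s; rewrite /K ext_d01.
have w2 s : web_weight (th^~ s) 0 *: th 0 s - - (web_weight (th^~ s) 1 *: th 1 s)
    = - web_weight (th^~ s) 2 *: th 2 s.
  have := web_weight_sum (th^~ s); rewrite sum3E => /eqP.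
  by rewrite addr_eq0 opprK scaleNr => /eqP.
have extN s : D s -> ext_d (fun q => - (web_weight (th^~ q) 1 *: th 1 q)) s 0 1
    = - K s 1.
  move=> Ds; rewrite (_ : (fun q => - _) =
    fun q => - (web_weight (th^~ q) 1) *: th 1 q); last first.
    by apply/funext => q; rewrite scaleNr.
  rewrite (ext_dZ (smoothN oD (sc 1)) (sth 1) Ds) /K (ext_dZ (sc 1) (sth 1) Ds).
  rewrite [RHS]opprD [in LHS]mulNr; congr (_ + _); rewrite -areaNl; congr area.
  by apply/rowP => j; rewrite !mxE pderivN//; exact: (smooth_diff (sc 1)).
have th01 s : area (th 0 s) (th 1 s) = web_weight (th^~ s) 2.
  by rewrite /web_weight !ord3E.
split.
- split=> //; first exact: smooth_mxN.
  apply: smooth_mxZ => //.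
    apply: smoothV => //; first by do ?apply: smoothM.
    by move=> s Ds; rewrite !mulf_neq0 ?c0.
  apply: smooth_mxD => //; last apply: smooth_mxN => //;
    by apply: smooth_mxZ => //; apply: smoothM => //; exact: sK.
- move=> s Ds; split.
  + by exists (web_weight (th^~ s) 0) => //; exact: c0.
  + exists (- web_weight (th^~ s) 1); last by rewrite scaleNr.
    by rewrite oppr_eq0 c0.
  + by rewrite w2; exists (- web_weight (th^~ s) 2); rewrite ?oppr_eq0 ?c0.
- move=> s Ds; split; apply: eq_alt2; do ?[exact: ext_d_alt|exact: wedge_alt].
    rewrite wedge01 /web_connection -/(K s 0) -/(K s 1).
    rewrite !(areaZl, areaZr, areaDl, areaNl) area_self [area (th 1 s) _]area_sym.
    rewrite th01; have := c0 0 s Ds; have := c0 1 s Ds; have := c0 2 s Ds.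
    by move=> *; field; do ?[apply/andP; split].
  rewrite extN// wedge01 /web_connection -/(K s 0) -/(K s 1).
  rewrite !(areaZl, areaZr, areaDl, areaNl, areaNr) area_self.
  rewrite th01; have := c0 0 s Ds; have := c0 1 s Ds; have := c0 2 s Ds.
  by move=> *; field; do ?[apply/andP; split].
Qed.

End WebConnection.

(** * Hydrodynamic surfaces *)

Section HydrodynamicFrame.
Variables (R : realType) (U : set 'rV[R]_3) (A : 'rV[R]_3 -> 'M[R]_3).
Variables (v : 'I_3 -> 'rV[R]_3 -> R) (w : 'I_3 -> 'rV[R]_3 -> 'rV[R]_3).
Variable dv : 'I_3 -> 'I_3 -> 'rV[R]_3 -> R.
Hypothesis oU : open U.
Hypothesis sv : forall i, smooth U (v i).
Hypothesis sw : forall i, smooth_mx U (w i).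
Hypothesis v_distinct : forall p, U p -> forall i j, i != j -> v i p != v j p.
Hypothesis w_neq0 : forall p, U p -> forall i, w i p != 0.
Hypothesis w_eigen : forall p, U p -> forall i, w i p *m A p = v i p *: w i p.
Hypothesis dv_def : forall p, U p -> forall i,
  grad (v i) p = \sum_(j < 3) dv i j p *: w j p.

Definition frame (p : 'rV[R]_3) : 'M[R]_3 := \matrix_i w i p.

Lemma mul_frame (x : 'rV[R]_3) p : x *m frame p = \sum_i x 0 i *: w i p.
Proof. by rewrite mulmx_sum_row; apply: eq_bigr => i _; rewrite rowK. Qed.

(** Eigenvectors of distinct eigenvalues: applying A - v_j and A - v_k to a linear relation kills
    two of its three terms. *)
Lemma frame_unit p : U p -> frame p \in unitmx.
Proof.
move=> Up; rewrite -row_free_unit; apply: inj_row_free => x.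
rewrite mul_frame => x0.
have step (y : 'I_3 -> R) c : \sum_i y i *: w i p = 0 ->
    \sum_i (y i * (v i p - c)) *: w i p = 0.
  move=> y0; transitivity ((\sum_i y i *: w i p) *m A p - c *: \sum_i y i *: w i p).
    rewrite mulmx_suml scaler_sumr -sumrB; apply: eq_bigr => i _.
    by rewrite -scalemxAl w_eigen// !scalerA -scalerBl mulrBr [c * _]mulrC.
  by rewrite y0 mul0mx scaler0 subr0.
apply/rowP => i; rewrite !mxE; apply/eqP; move: i.
have key i j k : i != j -> i != k -> (forall l, [|| l == i, l == j | l == k]) ->
    x 0 i == 0.
  move=> ij ik ijk; have := step _ (v k p) (step _ (v j p) x0).
  rewrite (bigD1 i)//= big1 ?addr0.
    move=> /eqP; rewrite scaler_eq0 (negbTE (w_neq0 Up i)) orbF !mulf_eq0.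
    by rewrite !subr_eq0 !(negbTE (v_distinct Up _))// !orbF.
  move=> l li; have := ijk l; rewrite (negbTE li) /= => /orP[]/eqP ->.
    by rewrite subrr mulr0 mul0r scale0r.
  by rewrite subrr mulr0 scale0r.
by apply: ord3_ind; [apply: (key 0 1 2)|apply: (key 1 0 2)|apply: (key 2 0 1)] => //;
  apply: ord3_ind.
Qed.

Lemma smooth_frame : smooth_mx U frame.
Proof.
move=> i j; rewrite (_ : (fun p => _) = fun p => w i p 0 j); first exact: sw.
by apply/funext => p; rewrite mxE.
Qed.

(** Only the expansion of d v^i is given; the coefficients are recovered by inverting the coframe,
    and inherit its smoothness. *)
Lemma smooth_dv i j : smooth U (dv i j).
Proof.
apply: (eq_smooth oU (f := fun p => (grad (v i) p *m invmx (frame p)) 0 j)).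
  move=> p Up; rewrite dv_def//.
  have -> : \sum_(l < 3) dv i l p *: w l p = (\row_l dv i l p) *m frame p.
    by rewrite mul_frame; apply: eq_bigr => l _; rewrite mxE.
  by rewrite mulmxK ?mxE//; exact: frame_unit.
apply: smooth_mulmx => //; first exact: smooth_grad.
by apply: smooth_invmx => //; [exact: smooth_frame|exact: frame_unit].
Qed.

Lemma v_sub_neq0 p i j : U p -> i != j -> v i p - v j p != 0.
Proof. by move=> Up ij; rewrite subr_eq0; exact: v_distinct. Qed.

Lemma ord3_neq (i : 'I_3) : (i != i + 1) * (i != i + 2) * (i + 1 != i + 2).
Proof. by move: i; apply: ord3_ind. Qed.

Lemma smooth_Omega : smooth_mx U (Omega v dv w).
Proof.
apply: smooth_mx_sum => // i; apply: smooth_mxZ => //.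
have half := smooth_cst oU (2^-1 : R).
by apply: smoothD => //; apply: smoothM => //; do ?[apply: smoothB => //];
  do ?[apply: smoothM => //]; do ?[exact: smooth_dv];
  apply: smoothV => //; do ?[apply: smoothB => //];
  move=> p Up; rewrite v_sub_neq0// ord3_neq.
Qed.

Lemma smooth_Omega_i i : smooth_mx U (Omega_i v dv w i).
Proof.
apply: smooth_mxZ => //; apply: smoothM => //.
  by apply: smoothM => //; [exact: smooth_dv|exact: smoothB].
apply: smoothV => //; first by apply: smoothM => //; exact: smoothB.
by move=> p Up; rewrite mulf_neq0// v_sub_neq0// ord3_neq.
Qed.

End HydrodynamicFrame.

Section MoreExteriorDerivative.
Variable R : realType.

Lemma ext_dZc (n : nat) (D : set 'rV[R]_n) (w : 'rV[R]_n -> 'rV[R]_n) c s :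
  smooth_mx D w -> D s -> ext_d (fun q => c *: w q) s = c *: ext_d w s.
Proof.
move=> sw Ds; apply/matrixP => a b; rewrite !mxE.
have E i j : pderiv i (fun q => (c *: w q) 0 j) s = c * pderiv i (fun q => w q 0 j) s.
  rewrite (_ : (fun q => _) = fun q => (fun=> c) q * w q 0 j).
    rewrite pderivM; first by rewrite pderiv_cst mulr0 addr0.
      exact: differentiable_cst.
    exact: (smooth_diff (sw 0 j)).
  by apply/funext => q; rewrite mxE.
by rewrite !E mulrBr.
Qed.

Lemma smooth_hodge (n : nat) (D : set 'rV[R]_n) (a b e : 'rV[R]_n -> 'rV[R]_2) :
  open D -> smooth_mx D a -> smooth_mx D b -> smooth_mx D e ->
  (forall s, D s -> area (a s) (b s) != 0) ->
  smooth_mx D (fun s => hodge (a s) (b s) (e s)).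
Proof.
move=> oD sa sb se ab0 i j.
apply: (eq_smooth oD (f := fun s => ((area (a s) (b s))^-1 *:
   (area (a s) (e s) *: b s - area (e s) (b s) *: a s)) i j)).
  by move=> s Ds; rewrite hodgeE// ab0.
apply: (@smooth_mxZ) => //; first by apply: smoothV => //; exact: smooth_area.
apply: smooth_mxD => //; last apply: smooth_mxN => //;
  by apply: smooth_mxZ => //; exact: smooth_area.
Qed.

Lemma pullback1_grad (n m : nat) (D : set 'rV[R]_n) (U : set 'rV[R]_m)
    (g : 'rV[R]_n -> 'rV[R]_m) (f : 'rV[R]_m -> R) s :
  smooth_mx D g -> smooth U f -> (forall s, D s -> U (g s)) -> D s ->
  grad (fun q => f (g q)) s = pullback1 g (grad f) s.
Proof.
move=> sg sf DU Ds; have dg j : differentiable (fun q => g q 0 j) s.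
  exact: (smooth_diff (sg 0 j)).
apply/rowP => a; rewrite !mxE pderiv_comp//; last exact: (smooth_diff sf (DU _ Ds)).
by apply: eq_bigr => j _; rewrite !mxE; congr (_ * _); rewrite -jacobianE// mxE.
Qed.

Lemma pullback1_sum (n m r : nat) (g : 'rV[R]_n -> 'rV[R]_m)
    (c : 'I_r -> 'rV[R]_m -> R) (w : 'I_r -> 'rV[R]_m -> 'rV[R]_m) s :
  pullback1 g (fun p => \sum_i c i p *: w i p) s =
  \sum_i c i (g s) *: pullback1 g (w i) s.
Proof.
by rewrite /pullback1 mulmx_suml; apply: eq_bigr => i _; rewrite scalemxAl.
Qed.

Lemma pullback1Z (n m : nat) (g : 'rV[R]_n -> 'rV[R]_m)
    (c : 'rV[R]_m -> R) (w : 'rV[R]_m -> 'rV[R]_m) s :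
  pullback1 g (fun p => c p *: w p) s = c (g s) *: pullback1 g w s.
Proof. by rewrite /pullback1 scalemxAl. Qed.

Lemma jacobian_comp (n m k : nat) (D : set 'rV[R]_n) (f : 'rV[R]_m -> 'rV[R]_k)
    (g : 'rV[R]_n -> 'rV[R]_m) (h : 'rV[R]_n -> 'rV[R]_k) s :
  open D -> D s -> (forall q, D q -> h q = f (g q)) ->
  (forall j, differentiable (fun q => f q 0 j) (g s)) ->
  (forall j, differentiable (fun q => g q 0 j) s) ->
  jacobian h s = jacobian g s *m jacobian f (g s).
Proof.
move=> oD Ds hfg df dg.
have e j q : D q -> f (g q) 0 j = h q 0 j by move=> Dq; rewrite hfg.
have dh j : differentiable (fun q => h q 0 j) s.
  apply: (eq_differentiable oD Ds (e j)).
  exact: (differentiable_row_comp (f := fun q => f q 0 j) (df j) dg).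
apply/matrixP => a j; rewrite [RHS]mxE.
transitivity (pderiv a (fun q => h q 0 j) s); first exact: jacobianE.
transitivity (pderiv a (fun q => f (g q) 0 j) s).
  by apply: (eq_pderiv a oD Ds) => q Dq; rewrite e.
rewrite (pderiv_comp (f := fun q => f q 0 j) a (df j) dg).
apply: eq_bigr => l _; rewrite mulrC.
by congr (_ * _); apply/esym; exact: jacobianE.
Qed.

End MoreExteriorDerivative.

(** * Pointwise algebra of the forms dx + v^i dt *)

Section CharacteristicForms.
Variables (R : realType) (X T : 'rV[R]_2) (v : 'I_3 -> R).
Hypothesis v_inj : forall i j, i != j -> v i - v j != 0.

Let psi i := X + v i *: T.

Lemma area_char i j : area (psi i) (psi j) = (v j - v i) * area X T.
Proof. by rewrite /area /psi !mxE; ring. Qed.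

Lemma area_charT i : area (psi i) T = area X T.
Proof. by rewrite /area /psi !mxE; ring. Qed.

(** By (v_j - v_k) psi_i = (v_i - v_k) psi_j - (v_i - v_j) psi_k, the argument is d li (psi_j / (v_i
    - v_j) - psi_k / (v_i - v_k)); the star changes the sign of its psi_j part. Rescaling psi_j and
    psi_k does not affect the star. *)
Lemma hodge_char i j k (li lj lk d : R) : i != j -> i != k -> j != k ->
  lj != 0 -> lk != 0 -> area X T != 0 ->
  hodge (lj *: psi j) (lk *: psi k)
    ((d * (v j - v k) / ((v i - v j) * (v i - v k))) *: (li *: psi i)) =
  - (d * li) *: ((v i - v k)^-1 *: psi k + (v i - v j)^-1 *: psi j).
Proof.
move=> ij ik jk lj0 lk0 XT0; have := v_inj ij; have := v_inj ik.
have vkj := v_inj jk; have vjk : v k - v j != 0 by rewrite -opprB oppr_eq0.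
move=> vik vij; rewrite hodgeE.
  rewrite !(areaZl, areaZr) !area_char; move: (area X T) XT0 => D D0.
  rewrite /psi; apply: row2P; rewrite !mxE; field;
    by rewrite D0 lk0 lj0 vjk vij vik.
by rewrite areaZl areaZr area_char !mulf_neq0.
Qed.

(** The structure equation of (v_j - v_k) psi_i at one point, with X = dx, T = dt and g_i = d v^i.
    The right side is the exterior derivative of that form, because d psi_i = d v^i /\ dt; the first
    argument of [area] on the left is the claimed connection form. *)
Lemma char_identity (n : 'I_3 -> 'I_3 -> R) i :
  let g i := \sum_j n i j *: psi j in
  (v (i + 1) - v (i + 2)) *
    area (- 1 *: (\sum_(i < 3) ((n (i + 1) i - 2^-1 * n i i) / (v i - v (i + 1)) +
            (n (i + 2) i - 2^-1 * n i i) / (v i - v (i + 2))) *: psi i) +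
          - 2^-1 *: (\sum_(i < 3) - n i i *: ((v i - v (i + 2))^-1 *: psi (i + 2) +
                       (v i - v (i + 1))^-1 *: psi (i + 1)))) (psi i)
  = area (g (i + 1) - g (i + 2)) (psi i)
    + (v (i + 1) - v (i + 2)) * area (g i) T.
Proof.
have v01 := v_inj (isT : 0 != 1 :> 'I_3); have v10 := v_inj (isT : 1 != 0 :> 'I_3).
have v02 := v_inj (isT : 0 != 2 :> 'I_3); have v20 := v_inj (isT : 2 != 0 :> 'I_3).
have v12 := v_inj (isT : 1 != 2 :> 'I_3); have v21 := v_inj (isT : 2 != 1 :> 'I_3).
have aE i j : area (psi i) (psi j) = (v j - v i) * area X T := area_char i j.
have aTE i : area (psi i) T = area X T := area_charT i.
(* With psi opaque, every area reduces to a multiple of [area X T] instead of being expanded in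
   components. *)
clearbody psi; rewrite /= !sum3E; move: i; apply: ord3_ind; rewrite !ord3E;
  rewrite !(areaDl, areaZl, areaNl) !aE !aTE;
  by move: (area X T) => D; field; rewrite v01 v10 v02 v20 v12 v21.
Qed.

End CharacteristicForms.

Lemma mulmx2 (R : pzRingType) (k l : nat) (M : 'M[R]_(k, 2)) (N : 'M[R]_(2, l)) :
  M *m N = col 0 M *m row 0 N + col 1 M *m row 1 N.
Proof. by apply/matrixP => a b; rewrite !mxE sum2E !big_ord1 !mxE. Qed.

(** * The connection form of a hydrodynamic surface *)

Section HydrodynamicSurface.
Variables (R : realType) (U : set 'rV[R]_3) (A : 'rV[R]_3 -> 'M[R]_3).
Variables (v : 'I_3 -> 'rV[R]_3 -> R) (w : 'I_3 -> 'rV[R]_3 -> 'rV[R]_3).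
Variable dv : 'I_3 -> 'I_3 -> 'rV[R]_3 -> R.
Hypothesis oU : open U.
Hypothesis sv : forall i, smooth U (v i).
Hypothesis sw : forall i, smooth_mx U (w i).
Hypothesis v_distinct : forall p, U p -> forall i j, i != j -> v i p != v j p.
Hypothesis w_neq0 : forall p, U p -> forall i, w i p != 0.
Hypothesis w_eigen : forall p, U p -> forall i, w i p *m A p = v i p *: w i p.
Hypothesis dv_def : forall p, U p -> forall i,
  grad (v i) p = \sum_(j < 3) dv i j p *: w j p.
Variables (D : set 'rV[R]_2) (sigma : 'rV[R]_2 -> 'rV[R]_3).
Hypothesis hyd : hydrodynamic_surface U A D sigma.
Hypothesis ind : forall s, D s -> pairwise_indep (fun i => pullback1 sigma (w i) s).

Lemma hydro_open : open D. Proof. by case: hyd. Qed.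

Lemma hydro_range s : D s -> U (sigma s).
Proof.
by case: hyd => _ [E [u [h [[_ _ EU _] _ DE _ e]]]] Ds; rewrite e//; apply/EU/DE.
Qed.

Lemma hydro_smooth : smooth_mx D sigma.
Proof.
case: hyd => oD [E [u [h [[_ su EU _] sh DE _ e]]]] i j.
apply: (eq_smooth oD (f := fun q => u (h q) i j)).
  by move=> q Dq; rewrite e.
by apply: (smooth_comp oD (su i j) (sh 0)).
Qed.

(* The eigenvector equation gives w_i . u_t = (w_i A) . u_x = v^i (w_i . u_x). *)
Lemma hydro_forms : exists x t : 'rV[R]_2 -> R, [/\ smooth D x, smooth D t &
  forall s, D s -> exists l : 'I_3 -> R, forall i,
    pullback1 sigma (w i) s = l i *: (grad x s + v i (sigma s) *: grad t s)].
Proof.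
case: hyd => oD [E [u [h [[oE su EU sol] sh DE _ e]]]].
exists (fun s => h s 0 0), (fun s => h s 0 1); split; [exact: sh|exact: sh|].
move=> s Ds; have Us := hydro_range Ds; have Eh := DE _ Ds.
have du j : differentiable (fun q => u q 0 j) (h s) by exact: (smooth_diff (su 0 j)).
have dh j : differentiable (fun q => h q 0 j) s by exact: (smooth_diff (sh 0 j)).
pose ux : 'rV[R]_3 := \row_j pderiv 0 (fun q => u q 0 j) (h s).
exists (fun i => (w i (sigma s) *m ux^T) 0 0) => i.
have J0 : row 0 (jacobian u (h s)) = ux.
  by apply/rowP => j; rewrite [LHS]mxE [RHS]mxE; exact: jacobianE.
have J1 : row 1 (jacobian u (h s)) = ux *m (A (sigma s))^T.
  apply/rowP => j; rewrite [LHS]mxE [RHS]mxE.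
  transitivity (pderiv 1 (fun q => u q 0 j) (h s)); first exact: jacobianE.
  rewrite sol// e//; apply: eq_bigr => k _; rewrite [in RHS]mxE [X in _ = _ * X]mxE.
  by rewrite mulrC.
rewrite /pullback1 (jacobian_comp oD Ds e du dh) trmx_mul mulmxA.
have hE b : row b (jacobian h s)^T = grad (fun q => h q 0 b) s.
  by apply/rowP => a; do 2!rewrite [LHS]mxE; rewrite [RHS]mxE; exact: jacobianE.
have cE b : col b (w i (sigma s) *m (jacobian u (h s))^T) =
    w i (sigma s) *m (row b (jacobian u (h s)))^T.
  by rewrite tr_row !colE mulmxA.
rewrite mulmx2 !hE !cE J0 J1 trmx_mul trmxK mulmxA w_eigen// -!scalemxAl.
pose m := w i (sigma s) *m ux^T; rewrite -/m.
have mE (c : 'rV[R]_2) : m *m c = m 0 0 *: c.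
  by rewrite {1}[m]mx11_scalar mul_scalar_mx.
rewrite !mE.
by rewrite scalerDr !scalerA [v _ _ * _]mulrC.
Qed.

Lemma hydro_web_smooth i : smooth_mx D (pullback1 sigma (w i)).
Proof.
apply: smooth_pullback1 (sw i) hydro_smooth hydro_range; exact: hydro_open.
Qed.

Lemma hydro_star_smooth i : smooth_mx D (star_Omega_i v dv w sigma i).
Proof.
apply: smooth_hodge => //; [exact: hydro_open|exact: hydro_web_smooth..| |].
  apply: (smooth_pullback1 hydro_open _ hydro_smooth hydro_range).
  exact: (smooth_Omega_i oU sv sw v_distinct w_neq0 w_eigen dv_def).
by move=> s Ds; have := web_weight_neq0 i (ind Ds).
Qed.

(** Written with scalar factors, instead of subtractions, to match [char_identity] and [ext_dZc]. *)
Definition hydro_connection (s : 'rV[R]_2) : 'rV[R]_2 :=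
  - 1 *: pullback1 sigma (Omega v dv w) s +
  - 2^-1 *: \sum_(i < 3) star_Omega_i v dv w sigma i s.

Lemma hydro_normalisation : exists ph1 ph2,
  web_normalisation D (fun i => pullback1 sigma (w i)) ph1 ph2 hydro_connection.
Proof.
have oD := hydro_open; have DU := hydro_range; have ss := hydro_smooth.
have [x [t [sx st form]]] := hydro_forms.
pose V i s := v i (sigma s).
pose psi i s := grad x s + V i s *: grad t s.
have sV i : smooth D (V i) by exact: smooth_comp oD _ _ _ _ (sv i) (ss 0) DU.
have sT : smooth_mx D (grad t) by exact: smooth_grad.
have sVT i : smooth_mx D (fun s => V i s *: grad t s) by exact: smooth_mxZ.
have spsi i : smooth_mx D (psi i).
  by apply: smooth_mxD => //; exact: smooth_grad.
have dpsi i s : D s -> ext_d (psi i) s 0 1 = area (grad (V i) s) (grad t s).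
  move=> Ds; rewrite (ext_dD (smooth_grad oD sx) (sVT i) Ds) mxE.
  by rewrite (ext_dZ (sV i) sT Ds) !(ext_d_grad oD _ Ds)// !mxE mulr0 addr0 add0r.
have ext i j k s : D s -> ext_d (fun s => (V j s - V k s) *: psi i s) s 0 1 =
    area (grad (V j) s - grad (V k) s) (psi i s)
    + (V j s - V k s) * area (grad (V i) s) (grad t s).
  move=> Ds; rewrite (ext_dZ (smoothB oD (sV j) (sV k)) (spsi i) Ds) dpsi//.
  congr (area _ _ + _); apply/rowP => a; rewrite !mxE pderivB//.
    exact: smooth_diff (sV j) Ds.
  exact: smooth_diff (sV k) Ds.
(* The factors l between the restricted eigenforms and psi are chosen point by point. Nothing has to
   be smooth in them, since neither the connection form nor the normalisation is defined through
   l. *)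
have key s : D s -> exists2 l : 'I_3 -> R,
    (forall i, l i != 0) /\ (forall i, pullback1 sigma (w i) s = l i *: psi i s) &
    forall i, (V (i + 1) s - V (i + 2) s) * area (hydro_connection s) (psi i s) =
    area (grad (V (i + 1)) s - grad (V (i + 2)) s) (psi i s)
    + (V (i + 1) s - V (i + 2) s) * area (grad (V i) s) (grad t s).
  move=> Ds; have [l lE] := form s Ds; exists l.
    (* The weight of index i + 1 pairs the forms i + 2 and i + 3 = i, so l i is one of its
       factors. *)
    split=> // i; have := web_weight_neq0 (i + 1) (ind Ds).
    rewrite /web_weight !lE areaZl areaZr.
    have -> : i + 1 + 2 = i :> 'I_3 by move: i; apply: ord3_ind; apply: val_inj.
    by apply: contra_neq => ->; rewrite mul0r mulr0.
  have l0 i : l i != 0.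
    have := web_weight_neq0 (i + 1) (ind Ds).
    rewrite /web_weight !lE areaZl areaZr.
    have -> : i + 1 + 2 = i :> 'I_3 by move: i; apply: ord3_ind; apply: val_inj.
    by apply: contra_neq => ->; rewrite mul0r mulr0.
  have vi i j : i != j -> V i s - V j s != 0.
    by move=> ij; rewrite subr_eq0; exact: v_distinct (DU s Ds) _ _ ij.
  have XT0 : area (grad x s) (grad t s) != 0.
    have := web_weight_neq0 0 (ind Ds); rewrite /web_weight !ord3E !lE.
    have aE i j : area (psi i s) (psi j s) = (V j s - V i s) *
      area (grad x s) (grad t s) := area_char _ _ (V^~ s) i j.
    rewrite areaZl areaZr aE; apply: contra_neq => ->.
    by rewrite !mulr0.
  pose n i j := dv i j (sigma s) * l j.
  have gE i : grad (V i) s = \sum_j n i j *: psi j s.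
    rewrite (pullback1_grad ss (sv i) DU Ds).
    transitivity (pullback1 sigma (fun p => \sum_(j < 3) dv i j p *: w j p) s).
      by rewrite /pullback1 dv_def//; exact: DU.
    by rewrite pullback1_sum; apply: eq_bigr => j _; rewrite lE scalerA.
  move=> i; rewrite !gE -(char_identity (grad x s) (grad t s) vi n i).
  congr (_ * area _ _).
  rewrite /hydro_connection; congr (_ *: _ + _ *: _).
    rewrite pullback1_sum; apply: eq_bigr => j _; rewrite lE scalerA.
    by congr (_ *: _); rewrite /n -/(V _ s) -/(V _ s); ring.
  apply: eq_bigr => j _; rewrite /star_Omega_i pullback1Z !lE.
  have [[j1 j2] j12] := ord3_neq j.
  exact: (hodge_char vi (l j) (dv j j (sigma s)) j1 j2 j12 (l0 _) (l0 _) XT0).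
(* The terms of the relation between the psi_i, the second with opposite sign, so that the
   difference is (V 1 - V 0) psi_2. *)
exists (fun s => (V 1 s - V 2 s) *: psi 0 s), (fun s => (V 0 s - V 2 s) *: psi 1 s).
split.
- split; [by apply: smooth_mxZ => //; exact: smoothB
         |by apply: smooth_mxZ => //; exact: smoothB|].
  apply: smooth_mxD => //; apply: smooth_mxZ => //; do ?[exact: smooth_cst].
    apply: smooth_pullback1 DU => //.
    exact: (smooth_Omega oU sv sw v_distinct w_neq0 w_eigen dv_def).
  by apply: smooth_mx_sum => // i; exact: hydro_star_smooth.
- move=> s Ds; have [l [l0 lE] _] := key s Ds.
  have vi i j : i != j -> V i s - V j s != 0.
    by move=> ij; rewrite subr_eq0; exact: v_distinct (DU s Ds) _ _ ij.
  rewrite !lE; split.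
  + exists ((V 1 s - V 2 s) / l 0); first by rewrite mulf_neq0 ?invr_neq0// vi.
    by rewrite scalerA divfK.
  + exists ((V 0 s - V 2 s) / l 1); first by rewrite mulf_neq0 ?invr_neq0// vi.
    by rewrite scalerA divfK.
  + exists ((V 1 s - V 0 s) / l 2); first by rewrite mulf_neq0 ?invr_neq0// vi.
    by rewrite scalerA divfK// /psi; apply: row2P; rewrite !mxE; ring.
- move=> s Ds; have [l _ K] := key s Ds.
  have := K 0; have := K 1; rewrite !ord3E => K1 K0.
  split; apply: eq_alt2; do ?[exact: ext_d_alt|exact: wedge_alt].
    by rewrite ext// wedge01 areaZr K0.
  (* The second form carries V 0 - V 2, the opposite of the cyclic factor V 2 - V 0 of K1. *)
  rewrite ext// wedge01 areaZr -(opprB (V 2 s)) [RHS]mulNr K1.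
  by rewrite -(opprB (grad (V 2) s)) areaNl [X in _ + X]mulNr [RHS]opprD.
Qed.

Lemma hydro_star_equation : star_equation v dv w D sigma.
Proof.
move=> C; have oD := hydro_open; have [ph1 [ph2 np]] := hydro_normalisation.
apply: (iff_trans (web_curvatureE oD C ind np)).
suff E s : D s -> ext_d hydro_connection s = - pullback2 sigma (ext_d (Omega v dv w)) s
    - 2^-1 *: ext_d (fun q => \sum_(i < 3) star_Omega_i v dv w sigma i q) s.
  by split=> H s Ds; rewrite H// E.
have sO := smooth_Omega oU sv sw v_distinct w_neq0 w_eigen dv_def.
have sP := smooth_pullback1 oD sO hydro_smooth hydro_range.
have sS : smooth_mx D (fun q => \sum_(i < 3) star_Omega_i v dv w sigma i q).
  by apply: smooth_mx_sum => // i; exact: hydro_star_smooth.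
move=> Ds; rewrite (pullback_ext_d oD oU hydro_smooth hydro_range sO Ds).
rewrite (ext_dD _ _ Ds).
    by rewrite (ext_dZc _ sP Ds) (ext_dZc _ sS Ds) scaleN1r scaleNr.
  by apply: smooth_mxZ => //; exact: smooth_cst.
by apply: smooth_mxZ => //; exact: smooth_cst.
Qed.

End HydrodynamicSurface.

(** * The equation on jets of graphs *)

Section JetCalculus.
Variable R : realType.
Implicit Types (P : 'rV[R]_12 -> R) (J : 'rV[R]_12) (a : 'I_2) (k l : 'I_12).

Notation o n := (inord n : 'I_12).

Lemma ord12_ind (Q : 'I_12 -> Prop) :
  (forall n, (n < 12)%N -> Q (o n)) -> forall k, Q k.
Proof. by move=> h k; rewrite -(inord_val k); exact: h. Qed.

(* The coordinate of the jet space that is the a-derivative of the l-th one;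
   only meaningful for 2 <= l < 8. *)
Definition jet_index (a : 'I_2) (l : nat) : nat :=
  (nth 0 [:: 0; 0; 3; 5; 6; 8; 9; 10] l + a)%N.

(** The derivatives of the jet coordinates along the graph. Those of the third order coordinates
    would be of order four; they get the value 0, which is harmless for functions of the first 8
    coordinates. *)
Definition jet_shift a J : 'rV[R]_12 := \row_(l < 12)
  (if (l < 2)%N then ((l : nat) == a)%:R
   else if (l < 8)%N then J 0 (o (jet_index a l)) else 0).

Definition total_deriv a P J : R := \sum_l pderiv l P J * jet_shift a J 0 l.

(** For m = 3, 5, 8: a function of the jet of order 0, 1, 2. *)
Definition depends (m : nat) P := forall J J',
  (forall k, (k < m)%N -> J 0 k = J' 0 k) -> P J = P J'.

(** The difference quotients themselves coincide, so P may be arbitrary. *)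
Lemma depends_pderiv m P l : depends m P -> depends m (pderiv l P).
Proof.
move=> dP J J' JJ; rewrite /pderiv /derive.
suff -> : (fun h : R => h^-1 *: ((P \o shift J) (h *: delta_mx 0 l) - P J)) =
    (fun h : R => h^-1 *: ((P \o shift J') (h *: delta_mx 0 l) - P J')) by [].
apply/funext => h /=; rewrite (dP _ _ JJ); congr (_ *: (_ - _)).
by apply: dP => k km; rewrite !mxE JJ.
Qed.

Lemma depends_pderiv0 m P k J : depends m P -> (m <= k)%N -> pderiv k P J = 0.
Proof.
move=> dP mk; rewrite /pderiv /derive.
suff -> : (fun h : R => h^-1 *: ((P \o shift J) (h *: delta_mx 0 k) - P J)) =
    fun=> 0 by rewrite lim_cst.
apply/funext => h /=; rewrite (dP _ J) ?subrr ?scaler0// => l lm.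
have lk : (l == k) = false by rewrite -val_eqE /= ltn_eqF// (leq_trans lm).
by rewrite !mxE lk andbF mulr0 add0r.
Qed.

Lemma depends_total P a : depends 5 P -> depends 8 (total_deriv a P).
Proof.
move=> dP J J' JJ; apply: eq_bigr => l _.
have [l5|l5] := leqP 5 l; first by rewrite !(depends_pderiv0 _ dP)// !mul0r.
have -> : pderiv l P J = pderiv l P J'.
  by apply: (depends_pderiv l dP) => k k5; apply: JJ; exact: leq_trans k5 _.
congr (_ * _); rewrite !mxE; case: ifP => // _; case: ifP => // _.
have ja : (jet_index a l < 8)%N.
  rewrite /jet_index; have := ltn_ord a; move: (val a) => b.
  by case: l l5 => -[|[|[|[|[|//]]]]] _ _ /=; lia.
by apply: JJ; rewrite inordK// (leq_trans ja).
Qed.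

Lemma smooth_jet_shift (W : set 'rV[R]_12) a l : open W ->
  smooth W (fun J => jet_shift a J 0 l).
Proof.
move=> oW; rewrite (_ : (fun J => _) = fun J => if (l < 2)%N then
    ((l : nat) == a)%:R else if (l < 8)%N then J 0 (o (jet_index a l)) else 0).
  by case: (l < 2)%N; [|case: (l < 8)%N]; do ?[exact: smooth_cst|exact: smooth_coord].
by apply/funext => J; rewrite mxE.
Qed.

Lemma smooth_total (W : set 'rV[R]_12) P a : open W -> smooth W P ->
  smooth W (total_deriv a P).
Proof.
move=> oW sP; apply: smooth_sum => // l; apply: smoothM => //.
  exact: smooth_pderiv.
exact: smooth_jet_shift.
Qed.

Lemma pderiv_jet_shift a l k J :
  pderiv k (fun J => jet_shift a J 0 l) J =
  ((2 <= l < 8) && ((k : nat) == jet_index a l))%N%:R.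
Proof.
rewrite (_ : (fun J => _) = fun J => if (l < 2)%N then
    ((l : nat) == a)%:R else if (l < 8)%N then J 0 (o (jet_index a l)) else 0).
  rewrite [(2 <= l)%N]leqNgt; case: (l < 2)%N => /=; first exact: pderiv_cst.
  case l8: (l < 8)%N => /=; last exact: pderiv_cst.
  rewrite pderiv_coord -val_eqE /= inordK// /jet_index.
  have := ltn_ord a; move: (val a) => b.
  by move: l8; case: l => -[|[|[|[|[|[|[|[|//]]]]]]]] _ _ /=; lia.
by apply/funext => J'; rewrite mxE.
Qed.

(** Differentiating in a coordinate that P does not involve leaves only the explicit factors
    [jet_shift], and selects the coordinates whose a-derivative is k. *)
Lemma pderiv_total (W : set 'rV[R]_12) m P a k J : open W -> W J ->
  smooth W P -> depends m P -> (m <= k)%N ->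
  pderiv k (total_deriv a P) J =
  \sum_l pderiv l P J * ((2 <= l < 8) && ((k : nat) == jet_index a l))%N%:R.
Proof.
move=> oW WJ sP dP mk.
have dp l : differentiable (pderiv l P) J.
  exact: smooth_diff (smooth_pderiv l sP) WJ.
have ds l : differentiable (fun J => jet_shift a J 0 l) J.
  exact: smooth_diff (smooth_jet_shift a l oW) WJ.
rewrite pderiv_sum; last by move=> l; exact: differentiableM.
apply: eq_bigr => l _; rewrite pderivM// pderiv_jet_shift//.
by rewrite (depends_pderiv0 _ (depends_pderiv l dP) mk) mulr0 addr0.
Qed.

Section Jet.
Variables (D : set 'rV[R]_2) (f : 'rV[R]_2 -> R).
Hypotheses (oD : open D) (sf : smooth D f).

Lemma smooth_foldr (u : seq 'I_2) : smooth D (foldr (@pderiv R 2) f u).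
Proof. by elim: u => //= a u; exact: smooth_pderiv. Qed.

Lemma smooth_jet3 k : smooth D (fun s => jet3 f s 0 k).
Proof.
have sF := smooth_foldr.
have S n : smooth D (fun s => [:: s 0 0; s 0 1; f s;
   foldr (@pderiv R 2) f [:: 0] s; foldr (@pderiv R 2) f [:: 1] s;
   foldr (@pderiv R 2) f [:: 0; 0] s; foldr (@pderiv R 2) f [:: 0; 1] s;
   foldr (@pderiv R 2) f [:: 1; 1] s;
   foldr (@pderiv R 2) f [:: 0; 0; 0] s; foldr (@pderiv R 2) f [:: 0; 0; 1] s;
   foldr (@pderiv R 2) f [:: 0; 1; 1] s; foldr (@pderiv R 2) f [:: 1; 1; 1] s]`_n).
  case: n => [|[|[|[|[|[|[|[|[|[|[|[|n]]]]]]]]]]]].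
  - exact: smooth_coord.
  - exact: smooth_coord.
  - exact: sf.
  - exact: (sF [:: 0]).
  - exact: (sF [:: 1]).
  - exact: (sF [:: 0; 0]).
  - exact: (sF [:: 0; 1]).
  - exact: (sF [:: 1; 1]).
  - exact: (sF [:: 0; 0; 0]).
  - exact: (sF [:: 0; 0; 1]).
  - exact: (sF [:: 0; 1; 1]).
  - exact: (sF [:: 1; 1; 1]).
  - apply: (eq_smooth oD (f := fun=> 0)) => [q _|]; last exact: smooth_cst.
    by rewrite /= nth_nil.
by apply: (eq_smooth oD _ (S k)) => s _; rewrite mxE.
Qed.

(** The jet lists each mixed derivative once, the operators for the first variable outermost.
    Applying the second one to f_0 or f_01 therefore takes one use of Schwarz, to f_00 two. *)
Lemma pderiv_jet3 a k s : D s -> (k < 8)%N ->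
  pderiv a (fun q => jet3 f q 0 k) s = jet_shift a (jet3 f s) 0 k.
Proof.
move=> Ds k8.
have sw b c u q : D q -> pderiv b (pderiv c (foldr (@pderiv R 2) f u)) q =
    pderiv c (pderiv b (foldr (@pderiv R 2) f u)) q.
  by move=> Dq; apply: (smooth_Schwarz _ _ oD _ Dq); exact: smooth_foldr.
have sw2 b c e u : pderiv b (pderiv c (pderiv e (foldr (@pderiv R 2) f u))) s =
    pderiv b (pderiv e (pderiv c (foldr (@pderiv R 2) f u))) s.
  by apply: (eq_pderiv _ oD Ds) => q Dq; exact: sw.
move: k k8; apply: ord12_ind => n n12; rewrite inordK// => n8.
have E (g : 'rV[R]_2 -> R) : (forall q, jet3 f q 0 (o n) = g q) ->
    pderiv a (fun q => jet3 f q 0 (o n)) s = pderiv a g s.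
  by move=> h; congr (pderiv a _ s); apply/funext.
pose d u q := foldr (@pderiv R 2) f u q.
have jE m q : (m < 12)%N -> jet3 f q 0 (o m) =
    [:: q 0 0; q 0 1; f q; d [:: 0] q; d [:: 1] q; d [:: 0; 0] q; d [:: 0; 1] q;
        d [:: 1; 1] q; d [:: 0; 0; 0] q; d [:: 0; 0; 1] q; d [:: 0; 1; 1] q;
        d [:: 1; 1; 1] q]`_m.
  by move=> m12; rewrite mxE inordK.
rewrite (E _ (fun q => jE n q n12)) [RHS]mxE inordK//.
clear E; move: n n12 n8 a; case=> [|[|[|[|[|[|[|[|n]]]]]]]] // _ _; apply: ord2_ind.
- exact: pderiv_coord.
- exact: pderiv_coord.
- exact: pderiv_coord.
- exact: pderiv_coord.
- by rewrite [RHS]jE.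
- by rewrite [RHS]jE.
- by rewrite [RHS]jE.
- by rewrite [RHS]jE; [exact: (sw 1 0 [::] s Ds)|].
- by rewrite [RHS]jE.
- by rewrite [RHS]jE.
- by rewrite [RHS]jE.
- by rewrite [RHS]jE; [exact: (etrans (sw 1 0 [:: 0] s Ds) (sw2 0 1 0 [::]))|].
- by rewrite [RHS]jE.
- by rewrite [RHS]jE; [exact: (sw 1 0 [:: 1] s Ds)|].
- by rewrite [RHS]jE.
- by rewrite [RHS]jE.
Qed.

(** The chain rule; the bound 8 keeps fourth derivatives of f out of it. *)
Lemma jet3_total P a s : D s -> depends 8 P -> differentiable P (jet3 f s) ->
  pderiv a (fun q => P (jet3 f q)) s = total_deriv a P (jet3 f s).
Proof.
move=> Ds dP DP; rewrite (pderiv_comp a DP); last first.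
  by move=> k; exact: smooth_diff (smooth_jet3 k) Ds.
apply: eq_bigr => k _; have [k8|k8] := leqP 8 k.
  by rewrite (depends_pderiv0 _ dP)// !mul0r.
by rewrite pderiv_jet3.
Qed.

End Jet.
End JetCalculus.

Section JetForms.
Variables (R : realType) (U V : set 'rV[R]_3) (psi : 'rV[R]_3 -> 'rV[R]_3).
Hypotheses (oU : open U) (psiP : coordinate_system U V psi).
Implicit Types (w : 'rV[R]_3 -> 'rV[R]_3) (J : 'rV[R]_12).

Notation o n := (inord n : 'I_12).

(* The restriction of a form of the hodograph space to the graph with jet J. *)
Definition jet_form w J : 'rV[R]_2 :=
  pullback1 psi w (jet_pt J) *m (jet_tangent J)^T.

Definition jet_dom : set 'rV[R]_12 := [set J | V (jet_pt J)].

Lemma coord_open : open V. Proof. by case: psiP. Qed.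
Lemma coord_smooth : smooth_mx V psi. Proof. by case: psiP. Qed.
Lemma coord_range y : V y -> U (psi y). Proof. by case: psiP => _ _ + _ _; apply. Qed.

Lemma open_jet_dom : open jet_dom.
Proof.
apply: (@open_comp _ _ (fun J : 'rV[R]_12 => jet_pt J)); last exact: coord_open.
move=> J _; apply: differentiable_continuous; apply: differentiable_row => j.
rewrite (_ : (fun q => _) = fun q : 'rV[R]_12 => q 0 (inord j)).
  exact: differentiable_coord.
by apply/funext => q; rewrite mxE.
Qed.

Lemma smooth_jet_pt W : open W -> smooth_mx W (@jet_pt R).
Proof.
move=> oW i j; apply: (eq_smooth oW (f := fun q => q 0 (inord j))).
  by move=> q _; rewrite mxE.
exact: smooth_coord.
Qed.

Lemma smooth_jet_tangent W : open W -> smooth_mx W (@jet_tangent R).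
Proof.
move=> oW a i; apply: (eq_smooth oW (f := fun J =>
  if (i < 2)%N then ((a : nat) == i)%:R else J 0 (o (3 + a)%N))).
  by move=> J _; rewrite mxE.
by case: (i < 2)%N; [exact: smooth_cst|exact: smooth_coord].
Qed.

Lemma smooth_jet_pullback w : smooth_mx U w ->
  smooth_mx jet_dom (fun J => pullback1 psi w (jet_pt J)).
Proof.
move=> sw; have oJ := open_jet_dom.
have sp := smooth_pullback1 coord_open sw coord_smooth coord_range.
by apply: (smooth_mx_comp oJ sp (smooth_jet_pt oJ)).
Qed.

Lemma smooth_jet_form w : smooth_mx U w -> smooth_mx jet_dom (jet_form w).
Proof.
move=> sw; have oJ := open_jet_dom.
apply: smooth_mulmx => //; first exact: smooth_jet_pullback.
by apply: smooth_trmx; exact: smooth_jet_tangent.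
Qed.

Lemma eq_jet_pt J J' : (forall k : 'I_12, (k < 3)%N -> J 0 k = J' 0 k) ->
  jet_pt J = jet_pt J'.
Proof.
move=> h; apply/rowP => i; rewrite !mxE; apply: h.
by rewrite inordK ?ltn_ord// (leq_trans (ltn_ord i)).
Qed.

Lemma eq_jet_tangent J J' : (forall k : 'I_12, (k < 5)%N -> J 0 k = J' 0 k) ->
  jet_tangent J = jet_tangent J'.
Proof.
move=> h; apply/matrixP => a i; rewrite !mxE; case: ifP => // _; apply: h.
have a5 : (3 + a < 5)%N by rewrite (ltn_add2l 3 a 2).
by rewrite inordK// (ltn_trans a5).
Qed.

Lemma eq_jet_form w J J' : (forall k : 'I_12, (k < 5)%N -> J 0 k = J' 0 k) ->
  jet_form w J = jet_form w J'.
Proof.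
move=> h; rewrite /jet_form (eq_jet_tangent h) (@eq_jet_pt J J')// => k k3.
by apply: h; exact: leq_trans k3 _.
Qed.

Lemma jet_formE w J :
  (jet_form w J 0 0 = pullback1 psi w (jet_pt J) 0 0
     + pullback1 psi w (jet_pt J) 0 2 * J 0 (o 3)) *
  (jet_form w J 0 1 = pullback1 psi w (jet_pt J) 0 1
     + pullback1 psi w (jet_pt J) 0 2 * J 0 (o 4)).
Proof.
rewrite /jet_form; move: (pullback1 psi w _) => r.
have tE a i : (jet_tangent J)^T i a =
    if (i < 2)%N then ((a : nat) == i)%:R else J 0 (o (3 + a)%N).
  by rewrite !mxE.
by split; rewrite [LHS]mxE sum3E !tE /= ?mulr1 ?mulr0 ?addr0 ?add0r.
Qed.

Lemma pderiv_affine (a b : 'rV[R]_12 -> R) (k l : 'I_12) J :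
  smooth jet_dom a -> smooth jet_dom b -> jet_dom J -> depends 3 a ->
  depends 3 b -> (3 <= k)%N ->
  pderiv k (fun J => a J + b J * J 0 l) J = (k == l)%:R * b J.
Proof.
move=> sa sb WJ da db k3.
have Da := smooth_diff sa WJ; have Db := smooth_diff sb WJ.
have Dl : differentiable (fun J : 'rV[R]_12 => J 0 l) J.
  exact: differentiable_coord.
rewrite pderivD//; last exact: differentiableM.
rewrite pderivM// pderiv_coord !(depends_pderiv0 _ _ k3)//.
by rewrite mulr0 addr0 add0r mulrC.
Qed.

(** The component along the dependent variable, that is, the rate at which the restricted form
    changes with the slopes f_0 and f_1. *)
Definition jet_vert w J : R := pullback1 psi w (jet_pt J) 0 2.

Lemma pderiv_jet_form w J : smooth_mx U w -> jet_dom J ->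
  (pderiv (o 3) (fun J => jet_form w J 0 0) J = jet_vert w J) *
  (pderiv (o 4) (fun J => jet_form w J 0 0) J = 0) *
  (pderiv (o 3) (fun J => jet_form w J 0 1) J = 0) *
  (pderiv (o 4) (fun J => jet_form w J 0 1) J = jet_vert w J).
Proof.
move=> sw WJ.
have sp i : smooth jet_dom (fun J => pullback1 psi w (jet_pt J) 0 i).
  exact: smooth_jet_pullback.
have dp i : depends 3 (fun J => pullback1 psi w (jet_pt J) 0 i).
  by move=> J1 J2 JJ; rewrite (eq_jet_pt JJ).
have e0 : (fun J => jet_form w J 0 0) = fun J => pullback1 psi w (jet_pt J) 0 0
     + pullback1 psi w (jet_pt J) 0 2 * J 0 (o 3).
  by apply/funext => J1; rewrite jet_formE.
have e1 : (fun J => jet_form w J 0 1) = fun J => pullback1 psi w (jet_pt J) 0 1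
     + pullback1 psi w (jet_pt J) 0 2 * J 0 (o 4).
  by apply/funext => J1; rewrite jet_formE.
have PA i j (k l : 'I_12) := @pderiv_affine _ _ k l J (sp i) (sp j) WJ (dp i) (dp j).
have E34 : (o 3 == o 4) = false by rewrite -val_eqE /= !inordK.
have E43 : (o 4 == o 3) = false by rewrite -val_eqE /= !inordK.
by rewrite e0 e1 !PA ?inordK// !eqxx E34 E43 !mul0r !mul1r.
Qed.

End JetForms.

Section GraphJets.
Variables (R : realType) (U V : set 'rV[R]_3) (psi : 'rV[R]_3 -> 'rV[R]_3).
Hypotheses (oU : open U) (psiP : coordinate_system U V psi).
Variables (D : set 'rV[R]_2) (f : 'rV[R]_2 -> R).
Hypotheses (oD : open D) (sf : smooth D f) (DV : forall s, D s -> V (graph_pt f s)).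

Lemma jet_pt3 s : jet_pt (jet3 f s) = graph_pt f s.
Proof.
apply/rowP; apply: ord3_ind; rewrite [LHS]mxE [RHS]mxE /=;
  by rewrite [LHS]mxE inordK.
Qed.

Lemma smooth_graph : smooth_mx D (graph_pt f).
Proof.
move=> i; apply: ord3_ind.
- apply: (eq_smooth oD (f := fun s => s 0 0)); last exact: smooth_coord.
  by move=> s _; rewrite mxE.
- apply: (eq_smooth oD (f := fun s => s 0 1)); last exact: smooth_coord.
  by move=> s _; rewrite mxE.
- by apply: (eq_smooth oD _ sf) => s _; rewrite mxE.
Qed.

Lemma jacobian_graph s : D s -> jacobian (graph_pt f) s = jet_tangent (jet3 f s).
Proof.
move=> Ds; apply/matrixP => a i; rewrite [RHS]mxE.
transitivity (pderiv a (fun q => graph_pt f q 0 i) s).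
  by apply: jacobianE => j; exact: (smooth_diff (smooth_graph 0 j)).
have E (g : 'rV[R]_2 -> R) : (forall q, graph_pt f q 0 i = g q) ->
    pderiv a (fun q => graph_pt f q 0 i) s = pderiv a g s.
  by move=> h; congr (pderiv a _ s); apply/funext.
move: i E; apply: ord3_ind => E.
- rewrite (E (fun q => q 0 0)) => [|q]; last by rewrite mxE.
  exact: pderiv_coord.
- rewrite (E (fun q => q 0 1)) => [|q]; last by rewrite mxE.
  exact: pderiv_coord.
- rewrite (E f) => [|q]; last by rewrite mxE.
  move: a {E}; apply: ord2_ind; rewrite /= [RHS]mxE inordK //.
Qed.

Lemma smooth_graph_surface : smooth_mx D (psi \o graph_pt f).
Proof.
exact: (smooth_mx_comp oD (coord_smooth psiP) smooth_graph DV).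
Qed.

Lemma graph_surface_range s : D s -> U ((psi \o graph_pt f) s).
Proof. by move=> Ds; apply: (coord_range psiP); exact: DV. Qed.

Lemma pullback1_graph w s : D s ->
  pullback1 (psi \o graph_pt f) w s = jet_form psi w (jet3 f s).
Proof.
move=> Ds.
have dpsi j : differentiable (fun q => psi q 0 j) (graph_pt f s).
  exact: (smooth_diff (coord_smooth psiP 0 j) (DV Ds)).
have dg j : differentiable (fun q => graph_pt f q 0 j) s.
  exact: (smooth_diff (smooth_graph 0 j) Ds).
have e q : D q -> (psi \o graph_pt f) q = psi (graph_pt f q) by [].
have JE := jacobian_comp oD Ds e dpsi dg.
by rewrite /jet_form /pullback1 JE jet_pt3 jacobian_graph// trmx_mul mulmxA.
Qed.

Lemma jet3_dom s : D s -> jet_dom V (jet3 f s).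
Proof. by move=> Ds; rewrite /jet_dom /= jet_pt3; exact: DV. Qed.

End GraphJets.

(** * Highest order coefficients of total derivatives *)

Section TotalDerivativeSymbols.
Variables (R : realType) (W : set 'rV[R]_12) (P : 'rV[R]_12 -> R).
Hypotheses (oW : open W) (sP : smooth W P).

Notation o n := (inord n : 'I_12).

Lemma sum_pick (E : 'I_12 -> R) (b : nat -> bool) m : (m < 12)%N ->
  (forall l, (l < 12)%N -> b l = (l == m)) -> \sum_l E l * (b l)%:R = E (o m).
Proof.
move=> m12 bE; rewrite (bigD1 (o m)) //= bE ?inordK// eqxx mulr1 big1 ?addr0//.
move=> l lm; rewrite bE ?ltn_ord// (_ : (_ == m) = false) ?mulr0//.
by apply: contraNF lm => /eqP <-; rewrite inord_val.
Qed.

Lemma pderiv_total_pick m a n r J : depends m P -> W J -> (m <= n < 12)%N ->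
  (r < 12)%N ->
  (forall l, (l < 12)%N -> (2 <= l < 8)%N && (n == jet_index a l) = (l == r)) ->
  pderiv (o n) (total_deriv a P) J = pderiv (o r) P J.
Proof.
move=> dP WJ /andP[mn n12] r12 bE.
have mo : (m <= o n)%N by rewrite inordK.
have T := pderiv_total a oW WJ sP dP mo; rewrite inordK// in T.
by rewrite T (sum_pick (fun l => pderiv l P J) r12 bE).
Qed.

Lemma pderiv_total_none m a n J : depends m P -> W J -> (m <= n < 12)%N ->
  (forall l, (l < 12)%N -> (2 <= l < 8)%N && (n == jet_index a l) = false) ->
  pderiv (o n) (total_deriv a P) J = 0.
Proof.
move=> dP WJ /andP[mn n12] bE.
have mo : (m <= o n)%N by rewrite inordK.
rewrite (pderiv_total a oW WJ sP dP mo) inordK//.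
by rewrite big1// => l _; rewrite bE ?mulr0// ltn_ord.
Qed.

(** Coordinates 3, 4, 5, 6 are f_0, f_1, f_00, f_01: the first total derivative produces f_00 from
    f_0 and f_01 from f_1, the second produces f_01 from f_0 and never f_00. *)
Lemma pderiv_total5 J : depends 5 P -> W J ->
  (pderiv (o 5) (total_deriv 0 P) J = pderiv (o 3) P J) *
  (pderiv (o 5) (total_deriv 1 P) J = 0) *
  (pderiv (o 6) (total_deriv 0 P) J = pderiv (o 4) P J) *
  (pderiv (o 6) (total_deriv 1 P) J = pderiv (o 3) P J).
Proof.
move=> dP WJ; split; [split; [split|]|].
- by apply: (pderiv_total_pick dP WJ) => //; do 12!case=> //.
- by apply: (pderiv_total_none dP WJ) => //; do 12!case=> //.
- by apply: (pderiv_total_pick dP WJ) => //; do 12!case=> //.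
- by apply: (pderiv_total_pick dP WJ) => //; do 12!case=> //.
Qed.

(** The same pattern one order higher, with f_00, f_01, f_000, f_001 as coordinates 5, 6, 8, 9. *)
Lemma pderiv_total8 J : depends 8 P -> W J ->
  (pderiv (o 8) (total_deriv 0 P) J = pderiv (o 5) P J) *
  (pderiv (o 8) (total_deriv 1 P) J = 0) *
  (pderiv (o 9) (total_deriv 0 P) J = pderiv (o 6) P J) *
  (pderiv (o 9) (total_deriv 1 P) J = pderiv (o 5) P J).
Proof.
move=> dP WJ; split; [split; [split|]|].
- by apply: (pderiv_total_pick dP WJ) => //; do 12!case=> //.
- by apply: (pderiv_total_none dP WJ) => //; do 12!case=> //.
- by apply: (pderiv_total_pick dP WJ) => //; do 12!case=> //.
- by apply: (pderiv_total_pick dP WJ) => //; do 12!case=> //.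
Qed.

Lemma pderiv_depM m (Q : 'rV[R]_12 -> R) (k : 'I_12) J : depends m P -> (m <= k)%N ->
  smooth W Q -> W J ->
  pderiv k (fun J => P J * Q J) J = P J * pderiv k Q J.
Proof.
move=> dP mk sQ WJ; rewrite pderivM.
- by rewrite (depends_pderiv0 _ dP mk) mulr0 addr0.
- exact: smooth_diff sP WJ.
- exact: smooth_diff sQ WJ.
Qed.

End TotalDerivativeSymbols.

Lemma det3E (R : comPzRingType) (M : 'M[R]_3) : \det M =
  M 0 0 * (M 1 1 * M 2 2 - M 1 2 * M 2 1)
  - M 0 1 * (M 1 0 * M 2 2 - M 1 2 * M 2 0)
  + M 0 2 * (M 1 0 * M 2 1 - M 1 1 * M 2 0).
Proof.
have l00 : lift (0 : 'I_3) (0 : 'I_2) = 1 by exact: val_inj.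
have l01 : lift (0 : 'I_3) (1 : 'I_2) = 2 by exact: val_inj.
have l10 : lift (1 : 'I_3) (0 : 'I_2) = 0 by exact: val_inj.
have l11 : lift (1 : 'I_3) (1 : 'I_2) = 2 by exact: val_inj.
have l20 : lift (2 : 'I_3) (0 : 'I_2) = 0 by exact: val_inj.
have l21 : lift (2 : 'I_3) (1 : 'I_2) = 1 by exact: val_inj.
rewrite (expand_det_row _ 0) sum3E /cofactor !det2E !mxE.
rewrite l00 l01 l10 l11 l20 l21 /=.
by ring.
Qed.

Lemma web_connectionE (R : realType) (th : 'I_3 -> 'rV[R]_2) (K : 'I_3 -> R) b :
  let d := (web_weight th 0 * web_weight th 1 * web_weight th 2)^-1 in
  web_connection th K 0 b = d * web_weight th 0 * th 0 0 b * K 1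
                          - d * web_weight th 1 * th 1 0 b * K 0.
Proof.
rewrite /= /web_connection.
move: (web_weight th 0) (web_weight th 1) ((web_weight th 0 * _ * _)^-1).
move: (th 0) (th 1) (K 0) (K 1) => a0 a1 K0 K1 c0 c1 d.
by rewrite !mxE; ring.
Qed.

(** * The third order equation and its symbol *)

Section JetEquation.
Variables (R : realType) (U : set 'rV[R]_3) (A : 'rV[R]_3 -> 'M[R]_3).
Variables (v : 'I_3 -> 'rV[R]_3 -> R) (w : 'I_3 -> 'rV[R]_3 -> 'rV[R]_3).
Variable dv : 'I_3 -> 'I_3 -> 'rV[R]_3 -> R.
Hypothesis oU : open U.
Hypothesis sv : forall i, smooth U (v i).
Hypothesis sw : forall i, smooth_mx U (w i).
Hypothesis v_distinct : forall p, U p -> forall i j, i != j -> v i p != v j p.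
Hypothesis w_neq0 : forall p, U p -> forall i, w i p != 0.
Hypothesis w_eigen : forall p, U p -> forall i, w i p *m A p = v i p *: w i p.
Hypothesis dv_def : forall p, U p -> forall i,
  grad (v i) p = \sum_(j < 3) dv i j p *: w j p.
Variables (V : set 'rV[R]_3) (psi : 'rV[R]_3 -> 'rV[R]_3).
Hypothesis psiP : coordinate_system U V psi.

Notation o n := (inord n : 'I_12).
Notation W := (jet_dom V).
Notation G := (admissible_jet w V psi).

Definition jet_web (J : 'rV[R]_12) (i : 'I_3) : 'rV[R]_2 := jet_form psi (w i) J.
Definition jet_weight i J : R := web_weight (jet_web J) i.
(** The coefficient of d(c_i th_i) along a graph as a function of the 2-jet; these are the numbers
    K_i of [web_connection]. *)
Definition jet_web_d i J : R :=
  total_deriv 0 (fun J => (jet_weight i J *: jet_web J i) 0 1) J -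
  total_deriv 1 (fun J => (jet_weight i J *: jet_web J i) 0 0) J.
Definition jet_connection J : 'rV[R]_2 :=
  web_connection (jet_web J) (jet_web_d^~ J).
Definition jet_hodge_sum J : 'rV[R]_2 :=
  \sum_(i < 3) hodge (jet_web J (i + 1)) (jet_web J (i + 2))
                     (jet_form psi (Omega_i v dv w i) J).
(** The first order part of the defect, which therefore cannot contribute to the third order
    symbol. *)
Definition jet_low J : 'rV[R]_2 :=
  jet_form psi (Omega v dv w) J + 2^-1 *: jet_hodge_sum J.
(** The connection form of the web minus the form - Omega - (sum of the * Omega^i) / 2; the equation
    says that it is closed along the graph. *)
Definition jet_defect J : 'rV[R]_2 := jet_connection J + jet_low J.
Definition jet_equation J : R :=
  total_deriv 0 (fun J => jet_defect J 0 1) J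
  - total_deriv 1 (fun J => jet_defect J 0 0) J.

Let oW : open W := open_jet_dom psiP.

Lemma admissible_dom J : G J -> W J. Proof. by case. Qed.

Lemma admissible_weight J i : G J -> jet_weight i J != 0.
Proof. by case=> _ ind; exact: web_weight_neq0 ind. Qed.

Lemma smooth_jet_web i : smooth_mx W (jet_web^~ i).
Proof. exact: (smooth_jet_form psiP (sw i)). Qed.

Lemma smooth_jet_weight i : smooth W (jet_weight i).
Proof. by apply: smooth_area => //; exact: smooth_jet_web. Qed.

(** Over V, a jet is admissible exactly when the product of its three weights, a smooth function,
    does not vanish. *)
Lemma open_admissible : open G.
Proof.
pose g J := jet_weight 0 J * jet_weight 1 J * jet_weight 2 J.
have sg : smooth W g by do ?apply: smoothM => //; exact: smooth_jet_weight.
rewrite openE => J GJ; have WJ := admissible_dom GJ.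
have gJ : g J != 0 by rewrite !mulf_neq0 ?admissible_weight.
have cg : {for J, continuous g}.
  exact: differentiable_continuous (smooth_diff sg WJ).
have n1 : \forall K \near J, g K != 0.
  exact: (cg _ (open_nbhs_nbhs (conj (@open_neq _ 0) gJ))).
have n2 : \forall K \near J, W K by exact: (open_near oW WJ).
move: n1 n2; apply: filterS2 => K gK WK; split=> //.
move: gK; rewrite /g !mulf_eq0 !negb_or => /andP[/andP[c0 c1] c2].
by apply: pairwise_indep_weight; apply: ord3_ind.
Qed.

Lemma admissibleS : G `<=` W. Proof. by move=> J /admissible_dom. Qed.

Lemma jet_web_dep (J J' : 'rV[R]_12) i :
  (forall k : 'I_12, (k < 5)%N -> J 0 k = J' 0 k) ->
  jet_web J i = jet_web J' i.
Proof. exact: eq_jet_form. Qed.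

Lemma jet_weight_dep i : depends 5 (jet_weight i).
Proof. by move=> J J' JJ; rewrite /jet_weight /web_weight !(jet_web_dep _ JJ). Qed.

Lemma jet_term_dep i b : depends 5 (fun J => (jet_weight i J *: jet_web J i) 0 b).
Proof. by move=> J J' JJ; rewrite (jet_weight_dep i JJ) (jet_web_dep _ JJ). Qed.

Lemma smooth_jet_term i : smooth_mx W (fun J => jet_weight i J *: jet_web J i).
Proof.
by apply: smooth_mxZ => //; [exact: smooth_jet_weight|exact: smooth_jet_web].
Qed.

Lemma jet_web_d_dep i : depends 8 (jet_web_d i).
Proof.
by move=> J J' JJ; congr (_ - _); apply: depends_total JJ; exact: jet_term_dep.
Qed.

Lemma smooth_jet_web_d i : smooth W (jet_web_d i).
Proof. by apply: smoothB => //; apply: smooth_total => //; exact: smooth_jet_term. Qed.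

Lemma jet_low_dep (J J' : 'rV[R]_12) : (forall k : 'I_12, (k < 5)%N -> J 0 k = J' 0 k) ->
  jet_low J = jet_low J'.
Proof.
move=> JJ; rewrite /jet_low (eq_jet_form _ _ JJ); congr (_ + _ *: _).
by apply: eq_bigr => i _; rewrite !(jet_web_dep _ JJ) (eq_jet_form _ _ JJ).
Qed.

Lemma smooth_jet_hodge_sum : smooth_mx G jet_hodge_sum.
Proof.
apply: smooth_mx_sum; first exact: open_admissible.
move=> i; have sO := smooth_Omega_i oU sv sw v_distinct w_neq0 w_eigen dv_def i.
apply: smooth_hodge; first exact: open_admissible.
- by move=> a b; apply: smoothS admissibleS _; exact: smooth_jet_web.
- by move=> a b; apply: smoothS admissibleS _; exact: smooth_jet_web.
- by move=> a b; apply: smoothS admissibleS _; exact: (smooth_jet_form psiP sO).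
- by move=> J GJ; exact: (admissible_weight i GJ).
Qed.

Lemma smooth_jet_low : smooth_mx G jet_low.
Proof.
have sO := smooth_Omega oU sv sw v_distinct w_neq0 w_eigen dv_def.
apply: smooth_mxD; first exact: open_admissible.
  by move=> a b; apply: smoothS admissibleS _; exact: (smooth_jet_form psiP sO).
apply: smooth_mxZ; [exact: open_admissible| |exact: smooth_jet_hodge_sum].
exact: smooth_cst open_admissible _.
Qed.

Definition jet_det_inv J : R :=
  (jet_weight 0 J * jet_weight 1 J * jet_weight 2 J)^-1.
Notation c := jet_weight.
Notation det_inv := jet_det_inv.

Lemma smooth_det_inv : smooth G det_inv.
Proof.
have oG := open_admissible.
have sc i : smooth G (c i) by apply: smoothS admissibleS _; exact: smooth_jet_weight.
apply: smoothV => //; first by do ?apply: smoothM.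
by move=> J GJ; rewrite !mulf_neq0 ?admissible_weight.
Qed.

Lemma jet_connectionE b J : jet_connection J 0 b =
  (det_inv J * c 0 J * jet_web J 0 0 b) * jet_web_d 1 J
  - (det_inv J * c 1 J * jet_web J 1 0 b) * jet_web_d 0 J.
Proof. exact: web_connectionE. Qed.

Lemma smooth_jet_coef i j b : smooth G (fun J => det_inv J * c i J * jet_web J j 0 b).
Proof.
have oG := open_admissible.
apply: smoothM => //; first (apply: smoothM => //; first exact: smooth_det_inv).
  by apply: smoothS admissibleS _; exact: smooth_jet_weight.
by apply: smoothS admissibleS _; exact: smooth_jet_web.
Qed.

Lemma jet_coef_dep i j b : depends 5 (fun J => det_inv J * c i J * jet_web J j 0 b).
Proof.
by move=> J J' JJ; rewrite /jet_det_inv !(jet_weight_dep _ JJ) (jet_web_dep _ JJ).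
Qed.

Lemma smooth_jet_connection : smooth_mx G jet_connection.
Proof.
have oG := open_admissible; move=> a b; rewrite (ord1 a).
apply: (eq_smooth oG (f := fun J =>
   (det_inv J * c 0 J * jet_web J 0 0 b) * jet_web_d 1 J
  - (det_inv J * c 1 J * jet_web J 1 0 b) * jet_web_d 0 J)).
  by move=> J _; rewrite jet_connectionE.
by apply: smoothB => //; apply: smoothM => //; do ?[exact: smooth_jet_coef];
  apply: smoothS admissibleS _; exact: smooth_jet_web_d.
Qed.

Lemma smooth_jet_defect : smooth_mx G jet_defect.
Proof.
by apply: smooth_mxD; [exact: open_admissible|exact: smooth_jet_connection
  |exact: smooth_jet_low].
Qed.

Lemma smooth_jet_equation : smooth G jet_equation.
Proof.
have oG := open_admissible.
by apply: smoothB => //; apply: smooth_total => //; exact: smooth_jet_defect.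
Qed.

Lemma jet_defect_dep b : depends 8 (fun J => jet_defect J 0 b).
Proof.
move=> J J' JJ; have JJ5 (k : 'I_12) : (k < 5)%N -> J 0 k = J' 0 k.
  by move=> k5; apply: JJ; exact: leq_trans k5 _.
rewrite /jet_defect (jet_low_dep JJ5) [LHS]mxE [RHS]mxE; congr (_ + _).
rewrite !jet_connectionE /jet_det_inv !(jet_weight_dep _ JJ5).
by rewrite !(jet_web_d_dep _ JJ) !(jet_web_dep _ JJ5).
Qed.

(** Weights, restricted forms and [jet_low] depend only on the 1-jet, so beyond it just the two
    factors [jet_web_d] vary. *)
Lemma pderiv_jet_defect b (k : 'I_12) J : (5 <= k)%N -> G J ->
  pderiv k (fun J => jet_defect J 0 b) J =
  det_inv J *
    (c 0 J * jet_web J 0 0 b * pderiv k (jet_web_d 1) J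
     - c 1 J * jet_web J 1 0 b * pderiv k (jet_web_d 0) J).
Proof.
move=> k5 GJ; have oG := open_admissible.
have sK i : smooth G (jet_web_d i).
  by apply: smoothS admissibleS _; exact: smooth_jet_web_d.
have sM i j l : smooth G (fun J => det_inv J * c i J * jet_web J j 0 b * jet_web_d l J).
  by apply: smoothM => //; exact: smooth_jet_coef.
have -> : (fun J => jet_defect J 0 b) = fun J =>
   ((det_inv J * c 0 J * jet_web J 0 0 b) * jet_web_d 1 J
  - (det_inv J * c 1 J * jet_web J 1 0 b) * jet_web_d 0 J) + jet_low J 0 b.
  by apply/funext => J'; rewrite -jet_connectionE [LHS]mxE.
have dlow : depends 5 (fun J => jet_low J 0 b).
  by move=> J1 J2 JJ; rewrite (jet_low_dep JJ).
rewrite pderivD; first last.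
- exact: smooth_diff (smooth_jet_low 0 b) GJ.
- exact: smooth_diff (smoothB oG (sM _ _ _) (sM _ _ _)) GJ.
rewrite (depends_pderiv0 _ dlow k5) addr0 pderivB; first last.
- exact: smooth_diff (sM _ _ _) GJ.
- exact: smooth_diff (sM _ _ _) GJ.
have X (d c0 c1 t0 t1 K0 K1 : R) : d * c0 * t0 * K1 - d * c1 * t1 * K0 =
    d * (c0 * t0 * K1 - c1 * t1 * K0) by ring.
rewrite (pderiv_depM (smooth_jet_coef 0 0 b) (jet_coef_dep 0 0 b) k5 (sK 1) GJ).
rewrite (pderiv_depM (smooth_jet_coef 1 1 b) (jet_coef_dep 1 1 b) k5 (sK 0) GJ).
exact: X.
Qed.

(** Each p_i is affine in f_0 alone and each q_i in f_1 alone, both with slope m_i. *)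
Lemma pderiv_jet_weight i J : W J ->
  let p i := jet_web J i 0 0 in let q i := jet_web J i 0 1 in
  let m i := jet_vert psi (w i) J in let j := i + 1 in let k := i + 2 in
  (pderiv (o 3) (c i) J = m j * q k - q j * m k) *
  (pderiv (o 4) (c i) J = p j * m k - m j * p k).
Proof.
move=> WJ /=.
have D j b : differentiable (fun J => jet_web J j 0 b) J.
  exact: smooth_diff (smooth_jet_web j 0 b) WJ.
have E k : pderiv k (c i) J = pderiv k (fun J => jet_web J (i + 1) 0 0 *
    jet_web J (i + 2) 0 1 - jet_web J (i + 1) 0 1 * jet_web J (i + 2) 0 0) J.
  by [].
have PF j := pderiv_jet_form psiP (sw j) WJ.
rewrite !E !pderivB; do ?[exact: differentiableM].
rewrite !pderivM// /jet_web !PF.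
by split; ring.
Qed.

(** In the coefficient of f_01 the two terms c_i m_i cancel: the exterior derivative of a restricted
    form has no second derivatives of f, so only the derivatives of the weight survive. *)
Lemma pderiv_jet_web_d i J : W J ->
  let p i := jet_web J i 0 0 in let q i := jet_web J i 0 1 in
  (pderiv (o 5) (jet_web_d i) J = pderiv (o 3) (c i) J * q i) *
  (pderiv (o 6) (jet_web_d i) J =
     pderiv (o 4) (c i) J * q i - pderiv (o 3) (c i) J * p i).
Proof.
move=> WJ /=.
have st b := smooth_jet_term i 0 b.
have dt b : depends 5 (fun J => (jet_weight i J *: jet_web J i) 0 b).
  exact: jet_term_dep.
have ds b a : differentiable
    (total_deriv a (fun J => (jet_weight i J *: jet_web J i) 0 b)) J.
  exact: smooth_diff (smooth_total a oW (st b)) WJ.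
have B k := pderivB k (ds 1 0) (ds 0 1).
have E b k : pderiv k (fun J => (jet_weight i J *: jet_web J i) 0 b) J =
    c i J * pderiv k (fun J => jet_form psi (w i) J 0 b) J +
    jet_web J i 0 b * pderiv k (c i) J.
  rewrite -pderivM; first by congr (pderiv k _ J); apply/funext => J'; rewrite [LHS]mxE.
    exact: smooth_diff (smooth_jet_weight i) WJ.
  exact: smooth_diff (smooth_jet_web i 0 b) WJ.
have F := pderiv_jet_form psiP (sw i) WJ.
have T b := pderiv_total5 oW (st b) (dt b) WJ.
split; apply: (etrans (B _)); rewrite !T !E !F; move: (pderiv _ (c i) J) => d3.
  by ring.
by move: (pderiv _ (c i) J) => d4; ring.
Qed.

(* Two coefficients of the third order symbol, which is -N / (c_0 c_1 c_2) times
   the product of the characteristic directions q_i xi - p_i eta. *)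
Lemma jet_equation_symbol J : G J ->
  let p i := jet_web J i 0 0 in let q i := jet_web J i 0 1 in
  let N := \sum_i c i J * jet_vert psi (w i) J in
  (pderiv (o 8) jet_equation J =
     - (det_inv J * N * (q 0 * q 1 * q 2))) *
  (pderiv (o 9) jet_equation J =
     det_inv J * N * (p 0 * q 1 * q 2 + q 0 * p 1 * q 2 + q 0 * q 1 * p 2)).
Proof.
move=> GJ p q N; have oG := open_admissible; have WJ := admissible_dom GJ.
have sd b := smooth_jet_defect 0 b.
have ds b a : differentiable (total_deriv a (fun J => jet_defect J 0 b)) J.
  exact: smooth_diff (smooth_total a oG (sd b)) GJ.
have k5 n : (n < 7)%N -> (5 <= n)%N -> (5 <= o n)%N.
  by move=> n7 n5; rewrite inordK// (leq_trans n7).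
have dd b : depends 8 (fun J => jet_defect J 0 b) by exact: jet_defect_dep.
have B k := pderivB k (ds 1 0) (ds 0 1).
have T b := pderiv_total8 oG (sd b) (dd b) GJ.
rewrite ![pderiv _ jet_equation J]B !T.
rewrite !pderiv_jet_defect ?k5//.
rewrite !(pderiv_jet_web_d _ WJ) /= !(pderiv_jet_weight _ WJ) /=.
rewrite /N sum3E !ord3E.
have cE i : c i J = p (i + 1) * q (i + 2) - q (i + 1) * p (i + 2) by [].
rewrite /p /q in cE *; rewrite !cE !ord3E.
move: (det_inv J) (jet_vert _ _ _) (jet_vert _ _ _) (jet_vert _ _ _).
by move=> d m0 m1 m2; split; ring.
Qed.

(* The sum is the determinant of the coframe pulled back by psi, since adding
   multiples of the vertical column to the others does not change it. *)
Lemma jet_vert_sum_neq0 J : W J -> \sum_i c i J * jet_vert psi (w i) J != 0.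
Proof.
move=> WJ; have [_ _ VU _ uJ] := psiP.
pose M := frame w (psi (jet_pt J)) *m (jacobian psi (jet_pt J))^T.
have uM : M \in unitmx.
  rewrite unitmx_mul unitmx_tr uJ// andbT.
  exact: (frame_unit v_distinct w_neq0 w_eigen (VU _ WJ)).
have ME i k : M i k = pullback1 psi (w i) (jet_pt J) 0 k.
  rewrite /M /pullback1 [LHS]mxE [RHS]mxE; apply: eq_bigr => l _.
  by rewrite [X in X * _]mxE.
move: uM; rewrite unitmxE unitfE det3E; apply: contraNN => /eqP N0.
apply/eqP; rewrite -[RHS]N0 sum3E /jet_weight /web_weight !ord3E /area /jet_web.
rewrite /jet_vert !jet_formE -!ME.
by ring.
Qed.

Lemma jet_equation_order3 J : G J ->
  exists2 k : 'I_12, (8 <= k)%N & pderiv k jet_equation J != 0.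
Proof.
move=> GJ; have WJ := admissible_dom GJ.
have [S8 S9] := jet_equation_symbol GJ.
have N0 := jet_vert_sum_neq0 WJ.
have d0 : det_inv J != 0 by rewrite invr_neq0// !mulf_neq0 ?admissible_weight.
have c0 i : c i J != 0 by exact: admissible_weight.
have cE i : c i J = jet_web J (i + 1) 0 0 * jet_web J (i + 2) 0 1
   - jet_web J (i + 1) 0 1 * jet_web J (i + 2) 0 0 by [].
have := c0 0; have := c0 1; have := c0 2; rewrite !cE !ord3E => h2 h1 h0.
(* If some q_i vanishes, the two weights that involve th_i are, up to sign, p_i times one of the
   other q. Hence p_i and both other q are nonzero, and exactly one term of the f_001 coefficient
   survives. *)
have [q0|q0] := eqVneq (jet_web J 0 0 1 * jet_web J 1 0 1 * jet_web J 2 0 1) 0.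
  exists (o 9); first by rewrite inordK.
  rewrite S9 mulf_neq0//; first by rewrite mulf_neq0.
  move/eqP: q0; rewrite !mulf_eq0 -orbA => /or3P[] /eqP e; rewrite e in h0 h1 h2 *.
  - rewrite !(mul0r, mulr0, subr0, sub0r, oppr_eq0, addr0, add0r, mulf_eq0,
      negb_or) in h0 h1 h2 *.
    by move: h1 h2 => /andP[e1 e2] /andP[e3 e4]; rewrite ?e1 ?e2 ?e3 ?e4.
  - rewrite !(mul0r, mulr0, subr0, sub0r, oppr_eq0, addr0, add0r, mulf_eq0,
      negb_or) in h0 h1 h2 *.
    by move: h0 h2 => /andP[e1 e2] /andP[e3 e4]; rewrite ?e1 ?e2 ?e3 ?e4.
  - rewrite !(mul0r, mulr0, subr0, sub0r, oppr_eq0, addr0, add0r, mulf_eq0,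
      negb_or) in h0 h1 h2 *.
    by move: h0 h1 => /andP[e1 e2] /andP[e3 e4]; rewrite ?e1 ?e2 ?e3 ?e4.
exists (o 8); first by rewrite inordK.
by rewrite S8 oppr_eq0 mulf_neq0// mulf_neq0.
Qed.

End JetEquation.

(** * The equation along a given graph *)

Section GraphEquation.
Variables (R : realType) (U : set 'rV[R]_3) (A : 'rV[R]_3 -> 'M[R]_3).
Variables (v : 'I_3 -> 'rV[R]_3 -> R) (w : 'I_3 -> 'rV[R]_3 -> 'rV[R]_3).
Variable dv : 'I_3 -> 'I_3 -> 'rV[R]_3 -> R.
Hypothesis oU : open U.
Hypothesis sv : forall i, smooth U (v i).
Hypothesis sw : forall i, smooth_mx U (w i).
Hypothesis v_distinct : forall p, U p -> forall i j, i != j -> v i p != v j p.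
Hypothesis w_neq0 : forall p, U p -> forall i, w i p != 0.
Hypothesis w_eigen : forall p, U p -> forall i, w i p *m A p = v i p *: w i p.
Hypothesis dv_def : forall p, U p -> forall i,
  grad (v i) p = \sum_(j < 3) dv i j p *: w j p.
Variables (V : set 'rV[R]_3) (psi : 'rV[R]_3 -> 'rV[R]_3).
Hypothesis psiP : coordinate_system U V psi.
Variables (D : set 'rV[R]_2) (f : 'rV[R]_2 -> R).
Hypotheses (oD : open D) (sf : smooth D f) (DV : forall s, D s -> V (graph_pt f s)).
Hypothesis ind : forall s, D s ->
  pairwise_indep (fun i => pullback1 (psi \o graph_pt f) (w i) s).

Notation sigma := (psi \o graph_pt f).
Notation th := (fun i => pullback1 sigma (w i)).
Notation conn := (fun s => web_connection (th^~ s)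
  (fun i => ext_d (fun q => web_weight (th^~ q) i *: th i q) s 0 1)).

Lemma graph_web s : D s -> th^~ s = jet_web w psi (jet3 f s).
Proof.
by move=> Ds; apply/funext => i; exact: (pullback1_graph psiP oD sf DV (w i) Ds).
Qed.

Lemma jet3_admissible s : D s -> admissible_jet w V psi (jet3 f s).
Proof.
move=> Ds; split; first exact: (jet3_dom DV Ds).
by have := ind Ds; rewrite graph_web.
Qed.

Lemma depends_le m k (P : 'rV[R]_12 -> R) : (m <= k)%N -> depends m P -> depends k P.
Proof.
by move=> mk dP J J' JJ; apply: dP => l lm; apply: JJ; exact: leq_trans lm mk.
Qed.

Lemma ext_d_jet3 (W : set 'rV[R]_12) (X : 'rV[R]_12 -> 'rV[R]_2) s :
  smooth_mx W X -> (forall s, D s -> W (jet3 f s)) ->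
  (forall b, depends 8 (fun J => X J 0 b)) -> D s ->
  ext_d (fun q => X (jet3 f q)) s 0 1 =
  total_deriv 0 (fun J => X J 0 1) (jet3 f s)
  - total_deriv 1 (fun J => X J 0 0) (jet3 f s).
Proof.
move=> sX DW dX Ds.
have T a b := jet3_total oD sf a Ds (dX b) (smooth_diff (sX 0 b) (DW _ Ds)).
by rewrite ext_d01 (T 0 1) (T 1 0).
Qed.

Lemma graph_web_d i s : D s ->
  ext_d (fun q => web_weight (th^~ q) i *: th i q) s 0 1 =
  jet_web_d w psi i (jet3 f s).
Proof.
move=> Ds; pose X J := jet_weight w psi i J *: jet_web w psi J i.
rewrite (@eq_ext_d _ _ D _ (fun q => X (jet3 f q)))//; last first.
  move=> q Dq; rewrite (graph_web Dq) /X -(graph_web Dq) //.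
  by rewrite graph_web.
apply: (ext_d_jet3 (smooth_jet_term sw psiP i)) => //.
  by move=> q Dq; exact: (jet3_dom DV Dq).
move=> b; apply: (@depends_le 5) => //; exact: jet_term_dep.
Qed.

Lemma graph_connection s : D s -> conn s = jet_connection w psi (jet3 f s).
Proof.
move=> Ds; rewrite /jet_connection -graph_web//; congr (web_connection _ _).
by apply/funext => i; exact: graph_web_d.
Qed.

Lemma graph_star_equation : star_equation v dv w D sigma <->
  forall s, D s -> jet_equation v w dv psi (jet3 f s) = 0.
Proof.
have ss := smooth_graph_surface psiP oD sf DV.
have DU := graph_surface_range psiP DV.
have sO := smooth_Omega oU sv sw v_distinct w_neq0 w_eigen dv_def.
have sOi i := smooth_Omega_i oU sv sw v_distinct w_neq0 w_eigen dv_def i.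
have sth i : smooth_mx D (th i) by exact: (smooth_pullback1 oD (sw i) ss DU).
have np := web_connectionP oD sth ind.
have [[_ _ sc] _ _] := np.
have sP := smooth_pullback1 oD sO ss DU.
have sS : smooth_mx D (fun q => \sum_(i < 3) star_Omega_i v dv w sigma i q).
  apply: smooth_mx_sum => // i; apply: smooth_hodge => //.
    exact: (smooth_pullback1 oD (sOi i) ss DU).
  by move=> s Ds; have := web_weight_neq0 i (ind Ds).
have sS2 : smooth_mx D (fun q => 2^-1 *: \sum_(i < 3) star_Omega_i v dv w sigma i q).
  by apply: smooth_mxZ => //; exact: smooth_cst.
(* All three exterior derivatives are gathered into the one of the defect, which is evaluated by
   total derivatives. *)
have E s : D s -> jet_equation v w dv psi (jet3 f s) =
    (ext_d conn s + (pullback2 sigma (ext_d (Omega v dv w)) s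
     + 2^-1 *: ext_d (fun q => \sum_(i < 3) star_Omega_i v dv w sigma i q) s)) 0 1.
  move=> Ds; rewrite (pullback_ext_d oD oU ss DU sO Ds) -(ext_dZc _ sS Ds).
  rewrite -(ext_dD sP sS2 Ds) -(ext_dD sc (smooth_mxD oD sP sS2) Ds).
  have sd := smooth_jet_defect oU sv sw v_distinct w_neq0 w_eigen dv_def psiP.
  have dd b : depends 8 (fun J => jet_defect v w dv psi J 0 b).
    exact: jet_defect_dep.
  have Q : ext_d (fun q => jet_defect v w dv psi (jet3 f q)) s =
      ext_d (fun q => conn q + (pullback1 sigma (Omega v dv w) q +
        2^-1 *: \sum_(i < 3) star_Omega_i v dv w sigma i q)) s.
    apply: (eq_ext_d oD Ds) => q Dq.
    rewrite graph_connection// (pullback1_graph psiP oD sf DV _ Dq).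
    rewrite (eq_bigr (fun i => hodge (jet_web w psi (jet3 f q) (i + 1))
      (jet_web w psi (jet3 f q) (i + 2))
      (jet_form psi (Omega_i v dv w i) (jet3 f q))))// => i _.
    by rewrite /star_Omega_i !(pullback1_graph psiP oD sf DV _ Dq).
  by rewrite -Q (ext_d_jet3 sd jet3_admissible dd Ds).
have I s : D s -> ext_d conn s = - pullback2 sigma (ext_d (Omega v dv w)) s
      - 2^-1 *: ext_d (fun q => \sum_(i < 3) star_Omega_i v dv w sigma i q) s <->
    jet_equation v w dv psi (jet3 f s) = 0.
  move=> Ds; rewrite (E s Ds) -opprD; set X := ext_d conn s; set Y := _ + _.
  split=> [->|h]; first by rewrite addNr mxE.
  apply/eqP; rewrite -addr_eq0; apply/eqP; apply: eq_alt2.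
  - rewrite linearD /= [X^T]ext_d_alt opprD; congr (_ + _).
    rewrite /Y linearD /= linearZ /= pullback2_alt ext_d_alt opprD.
    by rewrite scalerN.
  - by rewrite trmx0 oppr0.
  - by rewrite h mxE.
split=> [SE s Ds|JE C].
  (* The statement about all C is tested on the curvature of the normalisation by weights. *)
  apply/(I s Ds); apply: (proj1 (SE (fun s => ext_d conn s)) _ s Ds).
  by apply/(web_curvatureE oD _ ind np).
apply: (iff_trans (web_curvatureE oD C ind np)).
by split=> CE s Ds; rewrite CE//; have /(I s Ds) := JE s Ds.
Qed.

End GraphEquation.

Theorem theorem1 (R : realType) (U : set 'rV[R]_3)
  (A : 'rV[R]_3 -> 'M[R]_3)
  (v : 'I_3 -> 'rV[R]_3 -> R)
  (w : 'I_3 -> 'rV[R]_3 -> 'rV[R]_3)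
  (dv : 'I_3 -> 'I_3 -> 'rV[R]_3 -> R)
  (openU : open U)
  (smoothA : smooth_mx U A)
  (smoothv : forall i, smooth U (v i))
  (smoothw : forall i, smooth_mx U (w i))
  (v_distinct : forall p, U p -> forall i j, i != j -> v i p != v j p)
  (w_neq0 : forall p, U p -> forall i, w i p != 0)
  (w_eigen : forall p, U p -> forall i, w i p *m A p = v i p *: w i p)
  (dv_def : forall p, U p -> forall i,
     grad (v i) p = \sum_(j < 3) dv i j p *: w j p) :
  (forall (D : set 'rV[R]_2) (sigma : 'rV[R]_2 -> 'rV[R]_3),
     hydrodynamic_surface U A D sigma ->
     (forall s, D s -> pairwise_indep (fun i => pullback1 sigma (w i) s)) ->
     star_equation v dv w D sigma)
  /\
  (forall (V : set 'rV[R]_3) (psi : 'rV[R]_3 -> 'rV[R]_3),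
     coordinate_system U V psi ->
     exists F : 'rV[R]_12 -> R,
       [/\ smooth (admissible_jet w V psi) F,
           forall J, admissible_jet w V psi J ->
             exists2 k : 'I_12, (8 <= k)%N & pderiv k F J != 0 &
           forall (D : set 'rV[R]_2) (f : 'rV[R]_2 -> R),
             open D -> smooth D f -> (forall s, D s -> V (graph_pt f s)) ->
             (forall s, D s ->
                pairwise_indep (fun i => pullback1 (psi \o graph_pt f) (w i) s)) ->
             (star_equation v dv w D (psi \o graph_pt f) <->
              forall s, D s -> F (jet3 f s) = 0)]).
Proof.
split.
  move=> D sigma hyd ind.
  exact: (hydro_star_equation openU smoothv smoothw v_distinct w_neq0 w_eigen
    dv_def hyd ind).
move=> V psi psiP; exists (jet_equation v w dv psi); split.
- exact: (smooth_jet_equation openU smoothv smoothw v_distinct w_neq0 w_eigen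
    dv_def psiP).
- move=> J; exact: (jet_equation_order3 openU smoothv smoothw v_distinct w_neq0
    w_eigen dv_def psiP).
- move=> D f oD sf DV ind.
  exact: (graph_star_equation openU smoothv smoothw v_distinct w_neq0 w_eigen
    dv_def psiP oD sf DV ind).
Qed.
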